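(* Consider repeated non-credible second-price auctions (setting in the context) in which the credibility parameter $\alpha_0\in[0,1]$ is known to the bidder, the distribution $G$ of the highest competing bids is unknown, and the feedback is bandit feedback. Then: (1) if $\alpha_0=1$, truthful bidding ($b_t=v_t$ for all $t$) achieves zero regret; (2) if $\alpha_0=0$, there exists a bidding algorithm whose regret is $\widetilde{O}(T^{2/3})$, and the lower bound on regret for this case is $\Omega(T^{2/3})$, i.e. there is a problem instance on which every bidding algorithm incurs regret at least of order $T^{2/3}$; (3) if $\alpha_0\in(0,1)$, there exists a bidding algorithm whose regret is $\widetilde{O}(T^{1/2})$, and the lower bound on regret for this case is $\Omega(T^{1/2})$, i.e. for every bidding algorithm there is an instance on which its regret is at least of order $T^{1/2}$.
   Context: Setting (repeated non-credible second-price auctions). There are rounds $t=1,\dots,T$. In round $t$ the bidder observes a value $v_t\in[0,1]$, with $v_1,\dots,v_T$ i.i.d. from a distribution $F$ on $[0,1]$ unknown to the bidder, and submits a bid $b_t\in\mathbb{R}_+$. The highest competing bid $d_t\in\mathbb{R}_+$ is drawn i.i.d. from a distribution $G$ (CDF $G$), independently of the values. Let $x_t=\mathbb{I}\{b_t\ge d_t\}$. If $x_t=1$ the bidder pays $p_t=\alpha_0 d_t+(1-\alpha_0)b_t$, where $\alpha_0\in[0,1]$ is a fixed credibility parameter; otherwise she pays nothing. The cost is $c_t=x_tp_t$ and the reward is $r_t=x_tv_t-c_t$. Under bandit feedback the history available before bidding in round $t$ is $(v_s,x_s,c_s)_{s=1}^{t-1}$; under full feedback it is $(v_s,x_s,p_s)_{s=1}^{t-1}$.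 A bidding strategy (algorithm) maps the history and $v_t$ to a possibly random bid $b_t$; ''known $\alpha_0$'' means the strategy may depend on $\alpha_0$, ''unknown $G$'' means it may not depend on $G$ (it never depends on $F$). Define $r(v,b,\alpha)=(v-b)G(b)+\alpha\int_0^bG(y)\,dy$ and $b^*(v,\alpha)=\arg\max_b r(v,b,\alpha)$ (the largest maximizer in case of ties). The regret of a strategy $\pi$ is $\mathrm{Regret}(\pi)=\mathbb{E}\big[\sum_{t=1}^T r(v_t,b^*(v_t,\alpha_0),\alpha_0)-\sum_{t=1}^T r(v_t,b_t^\pi,\alpha_0)\big]$, the expectation being over values, competing bids and the strategy's randomness. $\widetilde{O}$ hides polylogarithmic factors in $T$.
   Formalization: In (2), the lower bound is proved as: for every bidding algorithm and every large T there is an instance with regret at least c T^{2/3}; one instance bad for every algorithm is impossible, since always bidding that instance's b*(v,0) has zero regret. *)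

(* Defs.v *)
From HB Require Import structures.
From mathcomp Require Import all_boot all_order all_algebra.
From mathcomp Require Import all_classical all_reals all_analysis.
Set Implicit Arguments. Unset Strict Implicit. Unset Printing Implicit Defensive.
Import Order.TTheory GRing.Theory Num.Theory.
Import numFieldNormedType.Exports.
Local Open Scope classical_set_scope.
Local Open Scope ring_scope.

Definition cdf (R : realType) (G : probability R R) (b : R) : R :=
  fine (G [set y : R | y <= b]).

Definition rew (R : realType) (G : probability R R) (v b alpha : R) : R :=
  (v - b) * cdf G b +
  let I : set R := `[0, b]%classic in
  alpha * fine (\int[lebesgue_measure]_(y in I) (cdf G y)%:E)%E.

(* r(v, b*(v,alpha), alpha) = max over bids b in R_+ of r(v,b,alpha)
   (b*(v,alpha) is by definition a maximizer; we use the maximal value itself). *)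
Definition best_rew (R : realType) (G : probability R R) (v alpha : R) : R :=
  sup [set rew G v b alpha | b in [set b : R | 0 <= b]].

(* What the bidder records about one round: (u_s, (v_s, x_s, c_s)), where
   u_s in [0,1] is the bidder's own private uniform random seed of round s
   and (v_s, x_s, c_s) is the bandit feedback (x_s in {0,1} as a real). *)
Definition round_info (R : realType) := (R * (R * R * R))%type.

(* A (possibly randomized) bidding strategy under bandit feedback:
   the bid of round t (0-based) is  A t h u v, where h is the recorded history of
   rounds 0..t-1, u is the fresh seed of round t and v = v_t. *)
Definition bandit_alg (R : realType) :=
  forall t : nat, t.-tuple (round_info R) -> R -> R -> R.

Definition alg_valid (R : realType) (A : bandit_alg R) : Prop :=
  forall t : nat,
    (forall h u v, 0 <= A t h u v) /\
    measurable_fun [set: t.-tuple (round_info R) * R * R]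
      (fun z => A t z.1.1 z.1.2 z.2).

Definition value_dist (R : realType) (F : probability R R) : Prop :=
  F `[0%R, 1%R]%classic = 1%E.
Definition bid_dist (R : realType) (G : probability R R) : Prop :=
  G [set y : R | 0 <= y] = 1%E.

(* Expected reward  E[ sum of r(v_s, b_s, alpha) over the n rounds t, ..., t+n-1 ]
   given the history h of the first t rounds; seeds are uniform on [0,1],
   values ~ F, competing bids ~ G, all independent. *)
Fixpoint exp_reward (R : realType) (alpha : R) (F G : probability R R)
  (A : bandit_alg R) (n t : nat) (h : t.-tuple (round_info R)) {struct n} : \bar R :=
  let U : set R := `[0, 1]%classic in
  match n with
  | 0 => 0%E
  | n'.+1 =>
    (\int[lebesgue_measure]_(u in U)
      \int[F]_v
        \int[G]_d
          let b := A t h u v in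
          let x : R := (if d <= b then 1 else 0)%R in
          let c : R := (x * (alpha * d + (1 - alpha) * b))%R in
          ((rew G v b alpha)%:E +
            exp_reward alpha F G A n' [tuple of rcons h ((u : R), (v, x, c))]))%E
  end.

Definition regret (R : realType) (alpha : R) (F G : probability R R)
  (A : bandit_alg R) (T : nat) : \bar R :=
  ((T%:R)%:E * (\int[F]_v (best_rew G v alpha)%:E)
   - exp_reward alpha F G A T [tuple])%E.

Definition truthful (R : realType) : bandit_alg R := fun t h u v => v.

(* Main.v *)
(** Every probabilistic estimate is a backward induction on the recursion that
    defines the expected reward: a potential function of the history is shown
    to dominate its own one-step average, so no product measure is built.

    At [alpha = 1] truthful bidding maximizes the one-round reward pointwise.

    Lower bounds: all values are 1 and the bidder faces finitely many
    distributions of competing bids, each with its own set of good bids. The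
    potential combines the likelihoods of these distributions with their
    relative entropies to a reference and bounds the number of good bids
    averaged over the distributions. For [alpha = 0] a needle of height about
    [T^(-1/3)] is hidden in one of about [T^(1/3)] intervals; for
    [0 < alpha < 1] two distributions at distance about [T^(-1/2)] suffice.

    Upper bounds: values, bids and competing bids are rounded to a grid, and
    exponential supermartingales control the empirical distribution function at
    every grid point. For [alpha = 0] an upper-confidence rule on [T^(1/3)] bids
    works for all values at once, since what is estimated does not depend on the
    value. For [alpha > 0] a payment reveals the competing bid, so a bid is
    informative about all lower bids. Optimal bids increase with the value;
    hence bidding the largest candidate not above any earlier bid made at a
    larger value makes every round with a larger value informative, and with
    [N] such rounds the regret is of order [N^(-1/2)]. *)
Require Import Defs.
From HB Require Import structures.
From mathcomp Require Import all_boot all_order all_algebra.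
From mathcomp Require Import all_classical all_reals all_analysis.
From mathcomp Require Import measurable_realfun ring lra.
Import Order.TTheory GRing.Theory Num.Theory.
Import numFieldNormedType.Exports.
Set Implicit Arguments. Unset Strict Implicit. Unset Printing Implicit Defensive.
Local Open Scope classical_set_scope.
Local Open Scope ring_scope.

(** * Integrals without measurability *)

(* The integral of a nonmeasurable function is here the difference of the lower
   integrals of its positive and negative parts. It is monotone, and on
   nonnegative functions superadditive, so the measurability of the expected
   reward in the history is never needed. *)
Section LowerIntegral.
Local Open Scope ereal_scope.
Context d (T : measurableType d) (R : realType) (mu : {measure set T -> \bar R}).
Import HBNNSimple.

(** In both lower bounds an exact tie is perturbed by [delta]: a wrong bid then costs order [delta],
    and an informative one reveals only order [delta ^ 2]. With two distributions every bid is
    informative, which forces [delta ^ 2 * T] to be of order 1. A needle is seen only by bids in its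
    own interval, so a typical one of [K] needles gets about [T / K] looks and stays hidden for
    [delta] of order [1 / K] and [T] about [K ^ 3]. The relative entropy enters through its chain
    rule, applied to one outcome at a time inside the recursion.

    For [0 < alpha < 1] the bound is uniform in the value distribution for this reason: if [t] is
    the probability of a value at least as large as the current one, about [n * t] of the first [n]
    rounds were informative, and the average of [(n * t) ^ (-1/2)] over the values is at most
    [2 * n ^ (-1/2)] whatever their law, being a lower sum for the integral of [x ^ (-1/2)] on
    [0, 1]. *)

Lemma ge0_le_integral_nomeas (D : set T) (f g : T -> \bar R) :
  (forall x, D x -> 0 <= f x) -> (forall x, D x -> f x <= g x) ->
  \int[mu]_(x in D) f x <= \int[mu]_(x in D) g x.
Proof.
move=> f0 fg.
have g0 x : D x -> 0 <= g x by move=> Dx; exact: le_trans (f0 _ Dx) (fg _ Dx).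
rewrite !ge0_integralE//; apply: ereal_sup_le => _ [h hf <-] /=.
exists h => //= x; apply: le_trans (hf x) _.
by rewrite /patch; case: ifPn => // /set_mem; exact: fg.
Qed.

Lemma le_integral_nomeas (D : set T) (f g : T -> \bar R) :
  (forall x, D x -> f x <= g x) ->
  \int[mu]_(x in D) f x <= \int[mu]_(x in D) g x.
Proof.
move=> fg; rewrite [leLHS]integralE [leRHS]integralE; apply: leeB.
  apply: ge0_le_integral_nomeas => x Dx; first exact: funepos_ge0.
  by rewrite !funeposE ge_max le_max fg//= le_max lexx orbT.
apply: ge0_le_integral_nomeas => x Dx; first exact: funeneg_ge0.
by rewrite !funenegE ge_max !le_max leeN2 fg//= lexx orbT.
Qed.

(** The lower integral is a supremum over simple functions, so estimates reduce to measurable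
    functions, for which linearity holds. *)
Lemma ge0_integral_lub (D : set T) (f : T -> \bar R) c :
  measurable D -> (forall x, D x -> 0 <= f x) ->
  (forall h : {nnsfun T >-> R}, (forall x, D x -> (h x)%:E <= f x) ->
     \int[mu]_(x in D) (h x)%:E <= c) ->
  \int[mu]_(x in D) f x <= c.
Proof.
move=> mD f0 H; rewrite ge0_integralE//; apply: ge_ereal_sup => _ [h hf <-].
have -> : sintegral mu h = \int[mu]_(x in D) (h x)%:E.
  rewrite integral_nnsfun//; congr sintegral; apply/funext => x.
  rewrite /patch; case: ifPn => // /negP Dx.
  have := hf x; rewrite /patch; case: ifPn => // _.
  rewrite lee_fin => hx; apply/eqP; rewrite eq_le hx/=; exact: fun_ge0.
apply: H => x Dx; have := hf x.
by rewrite /patch mem_set.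
Qed.

Lemma ge0_ae_le_integral_nomeas (E : set T) (f g : T -> \bar R) :
  measurable E -> mu (~` E) = 0 ->
  (forall x, 0 <= f x) -> (forall x, 0 <= g x) ->
  (forall x, E x -> f x <= g x) ->
  \int[mu]_x f x <= \int[mu]_x g x.
Proof.
move=> mE mu0 f0 g0 fg; apply: ge0_integral_lub => // h hf.
have -> : \int[mu]_x (h x)%:E = \int[mu]_(x in E) (h x)%:E.
  rewrite -[in RHS](setCK E) -[in RHS]setTD; apply: ge0_negligible_integral => //.
  - exact: measurableC.
  - exact/measurable_EFinP.
  - by move=> x _; rewrite lee_fin; exact: fun_ge0.
rewrite integral_mkcond; apply: ge0_le_integral_nomeas => x _.
  rewrite /patch; case: ifPn => // _; rewrite lee_fin; exact: fun_ge0.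
rewrite /patch; case: ifPn => // /set_mem Ex.
by apply: le_trans (fg _ Ex); exact: hf.
Qed.

Lemma ae_le_integral_nomeas (E : set T) (f g : T -> \bar R) :
  measurable E -> mu (~` E) = 0 -> (forall x, E x -> f x <= g x) ->
  \int[mu]_x f x <= \int[mu]_x g x.
Proof.
move=> mE mu0 fg; rewrite [leLHS]integralE [leRHS]integralE; apply: leeB.
  apply: (ge0_ae_le_integral_nomeas mE mu0) => x; rewrite ?funepos_ge0// => Ex.
  by rewrite !funeposE ge_max le_max fg//= le_max lexx orbT.
apply: (ge0_ae_le_integral_nomeas mE mu0) => x; rewrite ?funeneg_ge0// => Ex.
by rewrite !funenegE ge_max !le_max leeN2 fg//= lexx orbT.
Qed.

Lemma ae_eq_integral_nomeas (E : set T) (f g : T -> \bar R) :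
  measurable E -> mu (~` E) = 0 -> (forall x, E x -> f x = g x) ->
  \int[mu]_x f x = \int[mu]_x g x.
Proof.
move=> mE mu0 fg; apply/eqP; rewrite eq_le; apply/andP; split;
by apply: (ae_le_integral_nomeas mE mu0) => x /fg ->.
Qed.

(** Simple functions below [f] and [g] combine to one below [k f + g]; this half of linearity
    survives without measurability, and it is the half that averaging over hypotheses uses. *)
Lemma ge0_integral_superlinear (D : set T) (f g : T -> \bar R) (k : R) :
  measurable D -> (0 <= k)%R ->
  (forall x, D x -> 0 <= f x) -> (forall x, D x -> 0 <= g x) ->
  \int[mu]_(x in D) f x < +oo -> \int[mu]_(x in D) g x < +oo ->
  k%:E * \int[mu]_(x in D) f x + \int[mu]_(x in D) g x <=
    \int[mu]_(x in D) (k%:E * f x + g x).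
Proof.
move=> mD k0 f0 g0 foo goo.
have ffin : \int[mu]_(x in D) f x \is a fin_num.
  by rewrite ge0_fin_numE// integral_ge0.
have gfin : \int[mu]_(x in D) g x \is a fin_num.
  by rewrite ge0_fin_numE// integral_ge0.
move: k0; rewrite le_eqVlt => /predU1P[<-|k0].
  rewrite mul0e add0e; apply: le_integral_nomeas => x Dx.
  by rewrite mul0e add0e.
have kf0 x : D x -> 0 <= k%:E * f x.
  by move=> Dx; apply: mule_ge0 => //; [rewrite lee_fin ltW|exact: f0].
rewrite -leeBrDr//.
rewrite muleC -lee_pdivlMr//.
apply: ge0_integral_lub => // h1 h1f.
have mh (h : {nnsfun T >-> R}) : measurable_fun D (EFin \o h).
  apply/measurable_EFinP; exact: measurable_funTS.
have h0 (h : {nnsfun T >-> R}) x : D x -> 0 <= (h x)%:E.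
  by move=> _; rewrite lee_fin; exact: fun_ge0.
have I1fin : \int[mu]_(x in D) (h1 x)%:E \is a fin_num.
  rewrite ge0_fin_numE; last by apply: integral_ge0; exact: h0.
  by apply: le_lt_trans foo; apply: ge0_le_integral_nomeas => //; exact: h0.
rewrite lee_pdivlMr// muleC leeBrDr// addeC -leeBrDr; last first.
  by rewrite fin_numM.
apply: ge0_integral_lub => // h2 h2g.
rewrite leeBrDr ?fin_numM// -ge0_integralZl//; last by rewrite lee_fin ltW.
rewrite -ge0_integralD//; last 2 first.
- by move=> x Dx; apply: mule_ge0; [rewrite lee_fin ltW|exact: h0].
- by apply: measurable_funeM; exact: mh.
- apply: ge0_le_integral_nomeas => x Dx.
    by apply: adde_ge0; [exact: h0|apply: mule_ge0; [rewrite lee_fin ltW|exact: h0]].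
  rewrite addeC; apply: leeD; last exact: h2g.
  by apply: lee_wpmul2l; [rewrite lee_fin ltW|exact: h1f].
- exact: h0.
- exact: mh.
- exact: mh.
- exact: h0.
Qed.

Lemma ge0_le_sum_integral (D : set T) (I : Type) (s : seq I) (w : I -> R)
    (f : I -> T -> \bar R) (c : R) :
  measurable D -> mu D = 1 ->
  (forall i, 0 <= w i)%R -> (forall i x, D x -> 0 <= f i x) ->
  (forall i, \int[mu]_(x in D) f i x < +oo) ->
  (forall x, D x -> \sum_(i <- s) (w i)%:E * f i x <= c%:E) ->
  \sum_(i <- s) (w i)%:E * \int[mu]_(x in D) f i x <= c%:E.
Proof.
move=> mD muD w0 f0 foo fc.
have s0 s' x : D x -> 0 <= \sum_(i <- s') (w i)%:E * f i x.
  move=> Dx; apply: sume_ge0 => i _; apply: mule_ge0; last exact: f0.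
  by rewrite lee_fin.
have H s' : (forall x, D x -> \sum_(i <- s') (w i)%:E * f i x <= c%:E) ->
  \sum_(i <- s') (w i)%:E * \int[mu]_(x in D) f i x <=
    \int[mu]_(x in D) \sum_(i <- s') (w i)%:E * f i x.
  elim: s' => [|i s' IH] Hc.
    by rewrite big_nil; apply: integral_ge0 => x _; rewrite big_nil.
  rewrite big_cons; under [leRHS]eq_integral do rewrite big_cons.
  have Hc' x : D x -> \sum_(i <- s') (w i)%:E * f i x <= c%:E.
    move=> Dx; apply: le_trans (Hc x Dx); rewrite big_cons leeDr//.
    by apply: mule_ge0; [rewrite lee_fin|exact: f0].
  apply: le_trans (leeD2l _ (IH Hc')) _.
  apply: ge0_integral_superlinear => //; [exact: f0|exact: s0|].
  have /le_lt_trans := @le_integral_nomeas D _ (cst c%:E) Hc'; apply.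
  by rewrite integral_cst//= muD mule1 ltry.
apply: le_trans (H s fc) _.
have /le_trans := @le_integral_nomeas D _ (cst c%:E) fc; apply.
by rewrite integral_cst//= muD mule1.
Qed.

End LowerIntegral.

(** * The one-round reward *)

Section Reward.
Context (R : realType) (G : probability R R).
Local Notation mu := (@lebesgue_measure R).
Local Notation cdf := (Defs.cdf G).

Let mle (b : R) : measurable [set y : R | y <= b].
Proof. by rewrite -set_itvNyc; exact: measurable_itv. Qed.

Lemma cdfE b : (cdf b)%:E = G [set y | y <= b].
Proof. by rewrite /Defs.cdf fineK// fin_num_measure. Qed.

Lemma cdf_ge0 b : 0 <= cdf b.
Proof. by rewrite -lee_fin cdfE measure_ge0. Qed.

Lemma cdf_le1 b : cdf b <= 1.
Proof. by rewrite -lee_fin cdfE probability_le1. Qed.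

Lemma cdf_nondecreasing : {homo cdf : a b / a <= b}.
Proof.
move=> a b ab; rewrite -lee_fin !cdfE le_measure ?inE//.
by move=> y /= /le_trans; exact.
Qed.

Lemma measurable_cdf D : measurable D -> measurable_fun D cdf.
Proof. by move=> mD; apply: nondecreasing_measurable => // a b *; exact: cdf_nondecreasing. Qed.

Definition cdf_int b : R := fine (\int[mu]_(y in `[0%R, b]) (cdf y)%:E)%E.

Lemma integral_cdf_bounds (I : interval R) (a b : R) :
  [set` I] `<=` `[a, b] ->
  ((cdf a)%:E * mu [set` I] <= \int[mu]_(y in [set` I]) (cdf y)%:E <= (cdf b)%:E * mu [set` I])%E.
Proof.
move=> Iab.
rewrite -!integral_cst//; apply/andP; split; apply: ge0_le_integral_nomeas => y Iy; rewrite /= lee_fin ?cdf_ge0//.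
  by apply: cdf_nondecreasing; have := Iab y Iy; rewrite /= in_itv/= => /andP[].
by apply: cdf_nondecreasing; have := Iab y Iy; rewrite /= in_itv/= => /andP[].
Qed.

Lemma cdf_intE b : 0 <= b -> (\int[mu]_(y in `[0%R, b]) (cdf y)%:E = (cdf_int b)%:E)%E.
Proof.
move=> b0; rewrite fineK// ge0_fin_numE; last first.
  by apply: integral_ge0 => y _; rewrite lee_fin cdf_ge0.
have /andP[_ /le_lt_trans] := @integral_cdf_bounds `[0, b] 0 b (@subset_refl _ _); apply.
by rewrite lebesgue_measure_itv/= lte_fin; case: ifP => _; rewrite ?mule0// -EFinD -EFinM ltry.
Qed.

Lemma cdf_int0 : cdf_int 0 = 0.
Proof. by rewrite /cdf_int set_itv1 integral_set1. Qed.

Lemma cdf_int_bounds a b : 0 <= a -> a <= b ->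
  (b - a) * cdf a <= cdf_int b - cdf_int a <= (b - a) * cdf b.
Proof.
move=> a0 ab.
have b0 := le_trans a0 ab.
have H : ((cdf_int b)%:E = (cdf_int a)%:E + \int[mu]_(y in `]a, b]) (cdf y)%:E)%E.
  rewrite -!cdf_intE//.
  rewrite (_ : `[0, b]%classic = `[0, a] `|` `]a, b]); last first.
    by rewrite -itv_bndbnd_setU// bnd_simp.
  rewrite ge0_integral_setU//=.
  - by apply/measurable_EFinP; apply: measurable_cdf; apply: measurableU.
  - by move=> y _; rewrite lee_fin cdf_ge0.
  - rewrite disj_set2E; apply/eqP; rewrite -subset0 => y/= [].
    by rewrite !in_itv/= => /andP[_ ya] /andP[]; rewrite ltNge ya.
have := @integral_cdf_bounds `]a, b] a b (@subset_itv_oc_cc _ _ _ _).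
move: H; set J := (\int[mu]_(y in _) _)%E.
move=> H.
have -> : J = (cdf_int b - cdf_int a)%:E by rewrite EFinB H addeAC subee// add0e.
rewrite lebesgue_measure_itv/= lte_fin; case: ltP => [_|ba].
  by rewrite -EFinB -!EFinM !lee_fin ![cdf _ * _]mulrC.
have -> : b = a by apply/eqP; rewrite eq_le ab ba.
by rewrite !subrr !mul0r lexx.
Qed.

Lemma cdf_int_ge0 b : 0 <= b -> 0 <= cdf_int b.
Proof.
move=> b0; have /andP[+ _] := cdf_int_bounds (lexx 0) b0.
by rewrite cdf_int0 !subr0; apply: le_trans; rewrite mulr_ge0 ?cdf_ge0.
Qed.

Lemma cdf_int_le b : 0 <= b -> cdf_int b <= b * cdf b.
Proof. by move=> b0; have /andP[_] := cdf_int_bounds (lexx 0) b0; rewrite cdf_int0 !subr0. Qed.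

Lemma rewE v b alpha : rew G v b alpha = (v - b) * cdf b + alpha * cdf_int b.
Proof. by []. Qed.

(** Above [v] the first term loses [(b - v) G(b)], while the integral gains at most this much since
    [G] is nondecreasing. *)
Lemma rew_overbid v b alpha : alpha <= 1 -> 0 <= v -> v <= b ->
  rew G v b alpha <= rew G v v alpha.
Proof.
move=> a1 v0 vb; rewrite !rewE subrr mul0r add0r.
have /andP[] := cdf_int_bounds v0 vb.
have : 0 <= (b - v) * cdf v by rewrite mulr_ge0 ?subr_ge0 ?cdf_ge0.
move: (cdf v) (cdf b) (cdf_int v) (cdf_int b) => x y i j bv0 ij ji.
have : (1 - alpha) * (j - i) >= 0 by rewrite mulr_ge0 ?subr_ge0//; lra.
lra.
Qed.

(** For [b <= v] the rectangle of area [(v - b) G(b)] fits under the graph of [G] over [[b, v]]. *)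
Lemma rew_truthful v b : 0 <= v -> 0 <= b -> rew G v b 1 <= rew G v v 1.
Proof.
move=> v0 b0; have [vb|/ltW bv] := leP v b; first exact: rew_overbid.
rewrite !rewE subrr !mul0r !mul1r add0r.
have /andP[] := cdf_int_bounds b0 bv; nra.
Qed.

Lemma rew_nondecreasing v w b alpha : v <= w -> rew G v b alpha <= rew G w b alpha.
Proof.
move=> vw; rewrite !rewE lerD2r ler_wpM2r ?cdf_ge0//; lra.
Qed.

Lemma rew_lipschitz v w b alpha : `|rew G v b alpha - rew G w b alpha| <= `|v - w|.
Proof.
rewrite !rewE; have -> : (v - b) * cdf b + alpha * cdf_int b -
  ((w - b) * cdf b + alpha * cdf_int b) = (v - w) * cdf b by ring.
by rewrite normrM ler_piMr// ger0_norm ?cdf_ge0 ?cdf_le1.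
Qed.

Lemma rew_le v b alpha : 0 <= alpha <= 1 -> 0 <= v -> 0 <= b -> rew G v b alpha <= v.
Proof.
move=> /andP[a0 a1] v0 b0; rewrite rewE.
have bc := cdf_int_le b0.
have : (1 - alpha) * cdf_int b >= 0 by rewrite mulr_ge0 ?subr_ge0 ?cdf_int_ge0.
have : v * (1 - cdf b) >= 0 by rewrite mulr_ge0 ?subr_ge0 ?cdf_le1.
lra.
Qed.

Local Notation best := (best_rew G).

Let has_sup_rew v alpha : 0 <= alpha <= 1 ->
  has_sup [set rew G v b alpha | b in [set b : R | 0 <= b]].
Proof.
move=> a01; split; first by exists (rew G v 0 alpha); exists 0 => /=.
exists `|v| => _ [b b0 <-]; apply: le_trans (@rew_nondecreasing v `|v| b alpha _) _.
  exact: ler_norm.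
exact: rew_le.
Qed.

Lemma rew_le_best v b alpha : 0 <= alpha <= 1 -> 0 <= b -> rew G v b alpha <= best v alpha.
Proof. by move=> a01 b0; apply: sup_upper_bound; [exact: has_sup_rew|exists b]. Qed.

Lemma best_le v alpha M : (forall b, 0 <= b -> rew G v b alpha <= M) -> best v alpha <= M.
Proof.
move=> H; apply: ge_sup; first by exists (rew G v 0 alpha); exists 0 => /=.
by move=> _ [b b0 <-]; exact: H.
Qed.

Lemma best_le_trunc v alpha M : 0 <= alpha <= 1 -> 0 <= v ->
  (forall b, 0 <= b -> b <= v -> rew G v b alpha <= M) -> best v alpha <= M.
Proof.
move=> /andP[a0 a1] v0 H; apply: best_le => b b0; have [bv|/ltW vb] := leP b v; first exact: H.
by apply: le_trans (rew_overbid a1 v0 vb) _; exact: H.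
Qed.

Lemma best_nondecreasing v w alpha : 0 <= alpha <= 1 -> v <= w -> best v alpha <= best w alpha.
Proof.
move=> a01 vw; apply: best_le => b b0; apply: le_trans (rew_nondecreasing _ _ vw) _.
exact: rew_le_best.
Qed.

Lemma best_bounds v alpha : 0 <= alpha <= 1 -> 0 <= v -> 0 <= best v alpha <= v.
Proof.
move=> a01 v0; apply/andP; split; last by apply: best_le => b; exact: rew_le.
apply: le_trans (rew_le_best v a01 v0); rewrite rewE subrr mul0r add0r mulr_ge0 ?cdf_int_ge0//.
by case/andP: a01.
Qed.

Lemma best_truthful v : 0 <= v -> best v 1 = rew G v v 1.
Proof.
move=> v0; apply/eqP; rewrite eq_le rew_le_best ?ler01 ?lexx// andbT.
by apply: best_le => b; exact: rew_truthful.
Qed.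

Lemma measurable_best alpha : 0 <= alpha <= 1 -> measurable_fun setT (best^~ alpha).
Proof. by move=> a01; apply: nondecreasing_measurable => // a b *; exact: best_nondecreasing. Qed.

End Reward.

Lemma integral_prob_cst d (T : measurableType d) (R : realType)
  (P : probability T R) (r : R) : (\int[P]_x r%:E = r%:E)%E.
Proof. by rewrite integral_cst//= probability_setT mule1. Qed.

Lemma integral_seed_cst (R : realType) (r : R) :
  (\int[@lebesgue_measure R]_(u in `[0%R, 1%R]) r%:E = r%:E)%E.
Proof.
by rewrite integral_cst//= lebesgue_measure_itv/= lte_fin ltr01 oppr0 adde0 mule1.
Qed.

Section ValueDist.
Context (R : realType) (F G : probability R R) (alpha : R).
Hypotheses (hF : value_dist F) (a01 : 0 <= alpha <= 1).

Lemma value_dist_setC : F (~` `[0, 1]) = 0%E.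
Proof.
by rewrite probability_setC//; move: hF; rewrite /value_dist => ->; rewrite subee.
Qed.

Lemma integrable_best : F.-integrable setT (fun v => (best_rew G v alpha)%:E).
Proof.
have mN : measurable (~` `[0%R, 1%R] : set R) by apply: measurableC.
apply/(negligible_integrable mN measurableT _ value_dist_setC).
  by apply/measurable_EFinP; apply: measurable_best.
rewrite setTD setCK; apply: measurable_bounded_integrable => //=.
- by apply: le_lt_trans (ltry 1); apply: probability_le1.
- by apply: measurable_funTS; apply: measurable_best.
exists 1; split => // M M1 v; rewrite /= in_itv/= => /andP[v0 v1].
have /andP[b0 bv] := best_bounds G a01 v0.
by rewrite ger0_norm//; apply: le_trans (ltW M1); apply: le_trans bv v1.
Qed.

Definition mean_best : R := fine (\int[F]_v (best_rew G v alpha)%:E)%E.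

Lemma mean_bestE : (\int[F]_v (best_rew G v alpha)%:E = mean_best%:E)%E.
Proof. by rewrite fineK//; apply: integrable_fin_num => //; exact: integrable_best. Qed.

End ValueDist.

Lemma regret_truthful (R : realType) (F G : probability R R) (T : nat) :
  value_dist F -> regret 1 F G (@truthful R) T = 0%E.
Proof.
move=> hF; have a01 : 0 <= (1 : R) <= 1 by rewrite ler01 lexx.
rewrite /regret mean_bestE//.
suff H n t h : exp_reward 1 F G (@truthful R) n (t := t) h = (n%:R * mean_best F G 1)%:E.
  by rewrite H -EFinM subee.
elim: n t h => [|n IH] t h; first by rewrite mul0r.
rewrite /=; set m := mean_best F G 1.
rewrite -[RHS]integral_seed_cst; apply: eq_integral => u _.
transitivity (\int[F]_v ((best_rew G v 1)%:E + (n%:R * m)%:E))%E; last first.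
  rewrite integralD//; [|exact: integrable_best|exact: finite_measure_integrable_cst].
  by rewrite mean_bestE// integral_prob_cst -EFinD -natr1 mulrDl mul1r addrC.
apply: (ae_eq_integral_nomeas _ (value_dist_setC hF)) => // v; rewrite /= in_itv/= => /andP[v0 _].
rewrite best_truthful// -EFinD -[RHS](integral_prob_cst G); apply: eq_integral => x _.
by rewrite IH -EFinD.
Qed.

(** * Lower bounds *)

Section Entropy.
Context (R : realType).
Implicit Types w p q r : R.

Lemma ln_le_subr1 r : 0 < r -> ln r <= r - 1.
Proof. by move=> r0; have := @le_ln1Dx R (r - 1); rewrite (_ : 1 + (r - 1) = r); [apply|]; lra. Qed.

(* Summed over the outcomes, with likelihoods [w0] and [w], this is the
   Kullback-Leibler divergence; the term [w - w0] makes every summand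
   nonnegative. *)
Definition entropy_gap w0 w := w - w0 - w0 * ln (w / w0).

(** The tangent to [ln] at [8/7] bounds the entropy below by a function linear in [w]. This replaces
    Pinsker's inequality and, having no square root, can be summed over histories. *)
Lemma le_entropy_gap w0 w : 0 < w0 -> 0 < w ->
  w <= w0 + w / 8 + 7 * entropy_gap w0 w.
Proof.
move=> w00 w1; rewrite /entropy_gap; set r := w / w0.
have r0 : 0 < r by rewrite divr_gt0.
have wE : w = w0 * r by rewrite /r mulrC divfK// gt_eqF.
have -> : ln r = ln (r * (7 / 8)) + ln (8 / 7).
  by rewrite -lnM ?posrE; [congr ln| |]; lra.
have h1 : ln (r * (7 / 8)) <= r * (7 / 8) - 1 by apply: ln_le_subr1; lra.
have h2 : ln (8 / 7) <= 8 / 7 - 1 :> R by apply: ln_le_subr1; lra.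
rewrite wE; move: h1 h2; set a := ln _; set b := ln _ => h1 h2.
have : 0 <= w0 * (r * (7 / 8) - 1 + (8 / 7 - 1) - (a + b)) by apply: mulr_ge0; lra.
lra.
Qed.

(** Chain rule for one binary outcome: splitting the likelihoods adds [w0] times the relative
    entropy of two Bernoulli laws, which is at most their chi-square divergence. *)
Lemma entropy_gap_split w0 w p q : 0 < w0 -> 0 < w -> 0 < p < 1 -> 0 < q < 1 ->
  entropy_gap (w0 * p) (w * q) + entropy_gap (w0 * (1 - p)) (w * (1 - q)) <=
  entropy_gap w0 w + w0 * ((p - q) ^+ 2 / (q * (1 - q))).
Proof.
move=> w00 w1 /andP[p0 p1] /andP[q0 q1]; rewrite /entropy_gap.
have lnE a b : 0 < a -> 0 < b ->
  ln (w * a / (w0 * b)) = ln (w / w0) - ln (b / a).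
  move=> a0 b0; rewrite -ln_div ?posrE ?divr_gt0//; congr ln.
  by field; rewrite !gt_eqF.
rewrite !lnE ?subr_gt0//.
have h1 : ln (p / q) <= p / q - 1 by apply: ln_le_subr1; rewrite divr_gt0.
have h2 : ln ((1 - p) / (1 - q)) <= (1 - p) / (1 - q) - 1.
  by apply: ln_le_subr1; rewrite divr_gt0// subr_gt0.
have -> : (p - q) ^+ 2 / (q * (1 - q)) =
  p * (p / q - 1) + (1 - p) * ((1 - p) / (1 - q) - 1).
  by field; rewrite !gt_eqF// subr_gt0.
move: h1 h2; set L := ln (w / w0); set a := ln _; set b := ln _ => h1 h2.
have : 0 <= w0 * p * (p / q - 1 - a) by rewrite mulr_ge0 ?subr_ge0// mulr_ge0// ltW.
have : 0 <= w0 * (1 - p) * ((1 - p) / (1 - q) - 1 - b) by rewrite mulr_ge0 ?subr_ge0// mulr_ge0 ?subr_ge0// ltW.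
lra.
Qed.

End Entropy.

(** * Counting good bids averaged over hypotheses *)

Section Testing.
Context (R : realType) (I : finType) (A : bandit_alg R).
Context (good : I -> R -> bool) (P0 : R -> R) (P : I -> R -> R).
Context (out : bool -> R -> R * R) (kappa : R).
Local Notation mu := (@lebesgue_measure R).

Definition extend_history t (h : t.-tuple (round_info R)) (u : R) (v b : R) (o : bool) :
  t.+1.-tuple (round_info R) :=
  [tuple of rcons h (u, (v, (out o b).1, (out o b).2))].

(* Expected number of bids in the set [g] when all values are 1, a bid [b] wins
   with probability [p b], and the bidder is shown [out o b] for the outcome [o]. *)
Fixpoint hits (g : R -> bool) (p : R -> R) n t (h : t.-tuple (round_info R)) : R :=
  if n is n'.+1 then
    fine (\int[mu]_(u in `[0%R, 1%R])
      (let b := A h u 1 in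
       (g b)%:R + p b * hits g p n' (extend_history h u 1 b true)
                + (1 - p b) * hits g p n' (extend_history h u 1 b false))%:E)%E
  else 0.

Definition hits_step (g : R -> bool) (p : R -> R) n t (h : t.-tuple (round_info R)) (u : R) : R :=
  let b := A h u 1 in
  (g b)%:R + p b * hits g p n (extend_history h u 1 b true)
           + (1 - p b) * hits g p n (extend_history h u 1 b false).

Let integral_bounded (f : R -> R) (M : R) : (forall u, 0 <= f u <= M) ->
  let J := (\int[mu]_(u in `[0%R, 1%R]) (f u)%:E)%E in
  J = (fine J)%:E /\ 0 <= fine J <= M.
Proof.
move=> H J.
have J0 : (0 <= J)%E by apply: integral_ge0 => u _; rewrite lee_fin; have /andP[] := H u.
have JM : (J <= M%:E)%E.
  rewrite -[leRHS]integral_seed_cst.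
  by apply: le_integral_nomeas => u _; rewrite lee_fin; have /andP[] := H u.
have Jfin : J = (fine J)%:E.
  by rewrite fineK// ge0_fin_numE//; apply: le_lt_trans JM (ltry _).
by split => //; rewrite -!lee_fin -Jfin J0.
Qed.

Section HitsBounds.
Context (g : R -> bool) (p : R -> R) (p_01 : forall b, 0 <= p b <= 1).

Let step_bounds n : (forall t (h : t.-tuple (round_info R)), 0 <= hits g p n h <= n%:R) ->
  forall t (h : t.-tuple (round_info R)) u, 0 <= hits_step g p n h u <= n.+1%:R.
Proof.
move=> IH t h u; rewrite /hits_step; set b := A h u 1.
have /andP[p0 p1] := p_01 b.
have /andP[t0 tn] := IH _ (extend_history h u 1 b true).
have /andP[f0 fn] := IH _ (extend_history h u 1 b false).
have gb : 0 <= ((g b)%:R : R) <= 1 by rewrite ler0n lern1 leq_b1.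
rewrite -[n.+1%:R]natr1; move: (hits _ _ _ _) (hits _ _ _ _) t0 tn f0 fn gb => y x x0 xn y0 yn gb.
have := mulr_ge0 p0 x0; have : 0 <= (1 - p b) * y by rewrite mulr_ge0// subr_ge0.
have : 0 <= p b * (n%:R - x) by rewrite mulr_ge0// subr_ge0.
have : 0 <= (1 - p b) * (n%:R - y) by rewrite mulr_ge0// subr_ge0.
move: gb => /andP[g0 g1] h1 h2 h3 h4; apply/andP; split; lra.
Qed.

Lemma hits_bounds n t (h : t.-tuple (round_info R)) : 0 <= hits g p n h <= n%:R.
Proof.
elim: n t h => [|n IH] t h; first by rewrite lexx.
by have [_] := integral_bounded (step_bounds IH h).
Qed.

Lemma hits_step_bounds n t (h : t.-tuple (round_info R)) u : 0 <= hits_step g p n h u <= n.+1%:R.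
Proof. by apply: step_bounds => *; exact: hits_bounds. Qed.

Lemma hitsS n t (h : t.-tuple (round_info R)) :
  (\int[mu]_(u in `[0%R, 1%R]) (hits_step g p n h u)%:E = (hits g p n.+1 h)%:E)%E.
Proof. by have [] := integral_bounded (hits_step_bounds n h). Qed.

End HitsBounds.

Hypothesis A_ge0 : forall t (h : t.-tuple (round_info R)) u v, 0 <= A h u v.
Hypothesis good_uniq : forall (b : R) i j, 0 <= b -> good i b -> good j b -> i = j.
Hypothesis p01 : forall i b, 0 <= P i b <= 1.
Hypothesis p_close : forall b : R, 0 <= b ->
  (P0 b = 1 /\ forall i, P i b = 1) \/
  [/\ 0 < P0 b < 1, forall i, 0 < P i b < 1 &
    \sum_i (P0 b - P i b) ^+ 2 / (P i b * (1 - P i b)) <= kappa].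
Hypothesis kappa0 : 0 <= kappa.

(* The weights [w0] and [w i] are the likelihoods of the history under the
   reference [P0] and the hypothesis [P i]. The term in [kappa] pays for the
   growth of the relative entropies; it does not involve [#|I|] because a bid
   separates at most [kappa] in total over all hypotheses. *)
Definition hits_bound n (w0 : R) (w : I -> R) : R :=
  n%:R * w0 + n%:R / 8 * (\sum_i w i) +
  7 * (n%:R * (\sum_i entropy_gap w0 (w i)) + n%:R ^+ 2 * kappa * w0).

(** The left sum has at most one nonzero term, and [le_entropy_gap] is spent on it alone; the right
    side runs over all hypotheses because that index varies with the bid. *)
Lemma sum_good_le b (w0 : R) (w : I -> R) : 0 <= b -> 0 < w0 -> (forall i, 0 < w i) ->
  \sum_i w i * (good i b)%:R <= w0 + (\sum_i w i) / 8 + 7 * \sum_i entropy_gap w0 (w i).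
Proof.
move=> b0 w00 w1.
have gap0 i : 0 <= entropy_gap w0 (w i).
  rewrite /entropy_gap.
  have := ln_le_subr1 (divr_gt0 (w1 i) w00); set l := ln _ => hl.
  have : 0 <= w0 * (w i / w0 - 1 - l) by apply: mulr_ge0; [exact: ltW|rewrite subr_ge0].
  by rewrite !mulrBr mulr1 [w0 * (_ / _)]mulrC divfK// gt_eqF.
have S0 : 0 <= \sum_i entropy_gap w0 (w i) by apply: sumr_ge0.
have W0 : 0 <= \sum_i w i by apply: sumr_ge0 => i _; exact: ltW.
have [[i gi]|ng] := pselect (exists i, good i b); last first.
  rewrite big1; last first.
    by move=> i _; case: (boolP (good i b)) => [gi|_]; [case: ng; exists i|rewrite mulr0].
  lra.
rewrite (bigD1 i)//= gi mulr1 big1 ?addr0; last first.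
  move=> j ji; case: (boolP (good j b)) => [gj|_]; last by rewrite mulr0.
  by move: ji; rewrite (good_uniq b0 gi gj) eqxx.
have : w i <= \sum_i w i.
  by rewrite (bigD1 i)//= lerDl sumr_ge0// => j _; exact: ltW.
have : entropy_gap w0 (w i) <= \sum_i entropy_gap w0 (w i).
  by rewrite (bigD1 i)//= lerDl sumr_ge0.
have := le_entropy_gap w00 (w1 i); lra.
Qed.

(** One outcome adds at most [kappa * w0] of entropy, charged in each of the [n] remaining rounds;
    [n ^ 2 + n <= (n + 1) ^ 2] explains the quadratic term of [hits_bound]. *)
Lemma hits_bound_step n b (w0 : R) (w : I -> R) :
  0 <= b -> 0 < w0 -> (forall i, 0 < w i) -> 0 < P0 b < 1 -> (forall i, 0 < P i b < 1) ->
  \sum_i (P0 b - P i b) ^+ 2 / (P i b * (1 - P i b)) <= kappa ->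
  \sum_i w i * (good i b)%:R + hits_bound n (w0 * P0 b) (fun i => w i * P i b)
    + hits_bound n (w0 * (1 - P0 b)) (fun i => w i * (1 - P i b)) <= hits_bound n.+1 w0 w.
Proof.
move=> b0 w00 w1 P01 Pi1 Hk.
have Hg := sum_good_le b0 w00 w1.
rewrite /hits_bound.
have HW : \sum_i w i = \sum_i w i * P i b + \sum_i w i * (1 - P i b).
  by rewrite -big_split; apply: eq_bigr => i _ /=; ring.
have : \sum_i entropy_gap (w0 * P0 b) (w i * P i b) +
       \sum_i entropy_gap (w0 * (1 - P0 b)) (w i * (1 - P i b)) <=
       \sum_i entropy_gap w0 (w i) + w0 * kappa.
  rewrite -big_split.
  apply: (@le_trans _ _ (\sum_i (entropy_gap w0 (w i) +
    w0 * ((P0 b - P i b) ^+ 2 / (P i b * (1 - P i b)))))).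
    by apply: ler_sum => i _; apply: entropy_gap_split.
  by rewrite big_split/= lerD2l -mulr_sumr ler_pM2l.
move: HW Hg; set W := \sum_i w i; set W1 := \sum_i _ * P i b; set W2 := \sum_i _ * (1 - _).
set S := \sum_i entropy_gap w0 _; set S1 := \sum_i entropy_gap (_ * P0 b) _.
set S2 := \sum_i entropy_gap (_ * (1 - _)) _; set Gs := \sum_i _ * (good i b)%:R => HW Hg HS.
have n0 : 0 <= n%:R :> R by [].
rewrite -[n.+1%:R]natr1 HW; rewrite HW in Hg.
have h1 : 0 <= n%:R * (S + w0 * kappa - S1 - S2) by rewrite mulr_ge0//; lra.
have h2 : 0 <= (n%:R + 1) * (kappa * w0) by rewrite mulr_ge0 ?mulr_ge0 ?addr_ge0// ltW.
lra.
Qed.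

Lemma sum_hits_le n t (h : t.-tuple (round_info R)) (w0 : R) (w : I -> R) :
  0 < w0 -> (forall i, 0 < w i) ->
  \sum_i w i * hits (good i) (P i) n h <= hits_bound n w0 w.
Proof.
elim: n t h w0 w => [|n IH] t h w0 w w00 w1.
  by rewrite /hits_bound !mul0r expr0n !mul0r !(mulr0, addr0) big1// => i _; rewrite mulr0.
rewrite -lee_fin -sumEFin.
under eq_bigr do rewrite EFinM -hitsS//.
apply: ge0_le_sum_integral => //.
- by rewrite /= lebesgue_measure_itv/= lte_fin ltr01 oppr0 adde0.
- by move=> i; exact: ltW.
- by move=> i x _; rewrite lee_fin; have /andP[] := hits_step_bounds (good i) (p01 i) n h x.
- by move=> i; rewrite hitsS ?ltry.
move=> u _; under eq_bigr do rewrite -EFinM.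
rewrite sumEFin lee_fin /hits_step; set b := A h u 1.
have b0 : 0 <= b by exact: A_ge0.
under eq_bigr do rewrite !mulrDr !mulrA.
rewrite !big_split/=.
have [[P0b Pb]|[P0b Pb Hk]] := p_close b0.
  (* The outcome is certain under every hypothesis. The losing branch has likelihood 0, where the
     entropy argument would fail, but it contributes nothing. *)
  under [X in _ + X + _]eq_bigr do rewrite Pb mulr1.
  rewrite [X in _ + X](_ : _ = 0) ?addr0; last first.
    by apply: big1 => i _; rewrite Pb subrr mulr0 mul0r.
  apply: le_trans (lerD (sum_good_le b0 w00 w1) (IH _ _ _ _ w00 w1)) _.
  rewrite /hits_bound -[n.+1%:R]natr1.
  have h2 : 0 <= (2 * n%:R + 1) * (kappa * w0).
    by rewrite mulr_ge0 ?addr_ge0 ?mulr_ge0// ltW.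
  lra.
apply: le_trans (hits_bound_step n b0 w00 w1 P0b Pb Hk).
apply: lerD; first apply: lerD => //; apply: IH.
- by rewrite mulr_gt0//; case/andP: P0b.
- by move=> i; rewrite mulr_gt0//; case/andP: (Pb i).
- by rewrite mulr_gt0// subr_gt0; case/andP: P0b.
- by move=> i; rewrite mulr_gt0// subr_gt0; case/andP: (Pb i).
Qed.

(** With all weights 1 the entropies vanish, and some hypothesis is not above the average. *)
Lemma exists_hits_le n t (h : t.-tuple (round_info R)) : (0 < #|I|)%N ->
  exists i, hits (good i) (P i) n h <=
    n%:R / #|I|%:R + n%:R / 8 + 7 * n%:R ^+ 2 * kappa / #|I|%:R.
Proof.
move=> I0; pose M := n%:R / #|I|%:R + n%:R / 8 + 7 * n%:R ^+ 2 * kappa / #|I|%:R : R.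
have [//|nex] := pselect (exists i, hits (good i) (P i) n h <= M).
exfalso.
have I0' : 0 < #|I|%:R :> R by rewrite ltr0n.
have := @sum_hits_le n t h 1 (fun=> 1) ltr01 (fun=> ltr01).
under eq_bigr do rewrite mul1r.
rewrite /hits_bound /entropy_gap !sumr_const divr1 ln1 mulr0 subrr subr0 mul0rn mulr0 add0r !mulr1.
apply/negP; rewrite -ltNge.
have -> : n%:R + n%:R / 8 * #|I|%:R + 7 * (n%:R ^+ 2 * kappa) = \sum_(i : I) M.
  by rewrite sumr_const -mulr_natr /M; field; rewrite gt_eqF.
move: I0 => /card_gt0P[i0 _]; apply: (@ltr_sum R I (index_enum I) predT).
  by apply/hasP; exists i0.
by move=> i _; rewrite ltNge; apply/negP => Hi; apply: nex; exists i.
Qed.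
End Testing.

(** * Affine and two-valued integrands *)

Section AffineIntegrals.
Context d (T : measurableType d) (R : realType).
Import HBNNSimple.

(** Subadditivity, which fails in general for lower integrals, holds against a constant: a simple
    [h] below [c + k f] yields the measurable function [max (0, (h - c) / k)] below [f]. *)
Lemma ge0_integral_affine_le (mu : {measure set T -> \bar R}) (D : set T)
    (c k : R) (f : T -> R) :
  measurable D -> mu D = 1%E -> 0 <= c -> 0 <= k -> (forall x, 0 <= f x) ->
  (\int[mu]_(x in D) (c + k * f x)%:E <= c%:E + k%:E * \int[mu]_(x in D) (f x)%:E)%E.
Proof.
move=> mD muD c0 k0 f0; move: k0; rewrite le_eqVlt => /predU1P[<-|k0].
  under eq_integral do rewrite mul0r addr0.
  by rewrite mul0e adde0 integral_cst// muD mule1.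
apply: ge0_integral_lub => //.
  by move=> x _; rewrite lee_fin addr_ge0 ?mulr_ge0 // ltW.
move=> h hf; pose g x := Num.max 0 ((h x - c) / k).
have mg : measurable_fun D g.
  apply: measurable_maxr => //; apply: measurable_funM => //.
  by apply: measurable_funB => //; exact: measurable_funTS.
have g0 x : 0 <= g x by rewrite le_max lexx.
apply: (@le_trans _ _ (\int[mu]_(x in D) (c%:E + k%:E * (g x)%:E))%E).
  apply: le_integral_nomeas => x _; rewrite -EFinM -EFinD lee_fin -lerBlDl.
  by rewrite mulrC -ler_pdivrMr// le_max lexx orbT.
rewrite ge0_integralD//; last 2 first.
- by move=> x _; rewrite -EFinM lee_fin mulr_ge0// ltW.
- by apply: measurable_funeM; exact/measurable_EFinP.
rewrite integral_cst// muD mule1 leeD2l//.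
have -> : (\int[mu]_(x in D) (k%:E * (g x)%:E) = k%:E * \int[mu]_(x in D) (g x)%:E)%E.
  apply: ge0_integralZl => //; first exact/measurable_EFinP.
    by move=> x _; rewrite lee_fin.
  by rewrite lee_fin ltW.
apply: lee_wpmul2l; first by rewrite lee_fin ltW.
apply: le_integral_nomeas => x Dx; rewrite lee_fin ge_max f0/= ler_pdivrMr//.
by have := hf x Dx; rewrite lee_fin; lra.
Qed.

Lemma integral_two_valued (P : probability T R) (W : set T) (x y : R) :
  measurable W ->
  (\int[P]_z (if z \in W then x else y)%:E =
     (fine (P W) * x + (1 - fine (P W)) * y)%:E)%E.
Proof.
move=> mW.
transitivity (\int[P]_z (y%:E + (x - y)%:E * (\1_W z)%:E))%E.
  apply: eq_integral => z _; rewrite indicE -EFinM -EFinD; congr EFin.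
  by case: ifP => _ /=; ring.
have iW : P.-integrable setT (fun z => (\1_W z)%:E).
  by apply: integrable_indic => //; apply: le_lt_trans (ltry 1); exact: probability_le1.
rewrite integralD//; last 2 first.
- exact: finite_measure_integrable_cst.
- exact: integrableZl.
rewrite integral_prob_cst integralZl// integral_indic// setIT.
have PW : P W = (fine (P W))%:E by rewrite fineK// fin_num_measure.
rewrite [X in (_ + _ * X)%E]PW -EFinM -EFinD; congr EFin; ring.
Qed.

End AffineIntegrals.

(** * From good bids to regret *)

Section RewardHits.
Context (R : realType) (A : bandit_alg R) (alpha : R) (G : probability R R).
Context (E : set R) (W : R -> set R) (out : bool -> R -> R * R).
Context (good : R -> bool) (base gap : R).
Hypothesis A_ge0 : forall t (h : t.-tuple (round_info R)) u v, 0 <= A h u v.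
Hypotheses (mE : measurable E) (GE : G (~` E) = 0%E) (mW : forall b, measurable (W b)).
Hypothesis outE : forall b d : R, 0 <= b -> E d ->
  let x : R := if d <= b then 1 else 0 in
  (x, x * (alpha * d + (1 - alpha) * b)) = out (d \in W b) b.
Hypotheses (base0 : 0 <= base) (gap0 : 0 <= gap).
Hypothesis rew_good : forall b : R, 0 <= b -> rew G 1 b alpha <= base + gap * (good b)%:R.

Let p b := fine (G (W b)).

Let p01 b : 0 <= p b <= 1.
Proof.
rewrite /p -!lee_fin fineK ?fin_num_measure// measure_ge0/=.
exact: probability_le1.
Qed.

(** All values are 1 and the feedback to a bid [b] depends only on whether the competing bid lies in
    [W b], so for fixed seeds the histories form a binary tree, the one on which [hits] recurses. *)
Lemma exp_reward_le_hits n t (h : t.-tuple (round_info R)) :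
  (exp_reward alpha (dirac (1%R : R)) G A n h <=
    (n%:R * base + gap * hits A out good p n h)%:E)%E.
Proof.
elim: n t h => [|n IH] t h; first by rewrite mul0r mulr0 addr0.
rewrite [_ * base + _]addrC.
apply: (@le_trans _ _ (\int[@lebesgue_measure R]_(u in `[0%R, 1%R])
  (n.+1%:R * base + gap * hits_step A out good p n h u)%:E)%E); last first.
  rewrite EFinD EFinM -hitsS// addeC; apply: ge0_integral_affine_le => //.
  - by rewrite /= lebesgue_measure_itv/= lte_fin ltr01 oppr0 adde0.
  - by rewrite mulr_ge0.
  - by move=> u; have /andP[] := hits_step_bounds A out good p01 n h u.
apply: le_integral_nomeas => u _.
rewrite -[leRHS](integral_prob_cst (dirac (1%R : R))).
apply: (@ae_le_integral_nomeas _ _ _ (dirac (1%R : R)) [set 1%R]) => //.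
  by rewrite /= diracE memNset// => /=; exact.
move=> _ /= ->.
rewrite /hits_step; set b := A h u 1.
have b0 : 0 <= b by exact: A_ge0.
pose psi o := base + gap * (good b)%:R +
  (n%:R * base + gap * hits A out good p n (extend_history out h u 1 b o)).
apply: (@le_trans _ _ (\int[G]_d (if d \in W b then psi true else psi false)%:E)%E).
  apply: (ae_le_integral_nomeas mE GE) => d Ed.
  have -> : (if d \in W b then psi true else psi false) = psi (d \in W b) by case: ifP.
  rewrite /psi [X in (_ <= X)%E]EFinD; cbv zeta; apply: leeD; first by rewrite lee_fin; exact: rew_good.
  have /= := outE b0 Ed.
  rewrite /extend_history; case: (out _ _) => x c /= [-> ->].
  exact: IH.
rewrite integral_two_valued// lee_fin -/(p b) /psi -[n.+1%:R]natr1; lra.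
Qed.

Lemma value_dist_dirac1 : value_dist (dirac (1%R : R)).
Proof. by rewrite /value_dist /= diracE mem_set//= in_itv/= ler01 lexx. Qed.

Lemma regret_ge_hits T b : 0 <= alpha <= 1 -> 0 <= b -> base + gap <= rew G 1 b alpha ->
  ((gap * (T%:R - hits A out good p T [tuple]))%:E <= regret alpha (dirac (1%R : R)) G A T)%E.
Proof.
move=> a01 b0 Hb; rewrite /regret.
have -> : (\int[dirac (1%R : R)]_v (best_rew G v alpha)%:E = (best_rew G 1 alpha)%:E)%E.
  rewrite -[RHS](integral_prob_cst (dirac (1%R : R))).
  apply: (@ae_eq_integral_nomeas _ _ _ (dirac (1%R : R)) [set 1%R]) => //; last by move=> _ ->.
  by rewrite /= diracE memNset// => /=; exact.
have -> : gap * (T%:R - hits A out good p T [tuple]) =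
  T%:R * (base + gap) - (T%:R * base + gap * hits A out good p T [tuple]) by ring.
rewrite EFinB; apply: leeB; last exact: exp_reward_le_hits.
rewrite -EFinM lee_fin ler_wpM2l//; apply: le_trans Hb _; exact: rew_le_best.
Qed.

End RewardHits.

(** * Finitely supported distributions *)

Section DiscreteProbability.
Context (R : realType).

Lemma discrete_probability (n : nat) (x m : nat -> R) :
  (forall i, 0 <= m i) -> \sum_(i < n) m i = 1 ->
  exists G : probability R R, forall B : set R, G B = (\sum_(i < n) m i * (x i \in B)%:R)%:E.
Proof.
move=> m0 m1.
pose mu : {measure set R -> \bar R} := msum (fun i : nat => mscale (NngNum (m0 i)) (dirac (x i))) n.
have muE (B : set R) : mu B = (\sum_(i < n) m i * (x i \in B)%:R)%:E.
  by rewrite /mu /msum -sumEFin; apply: eq_bigr => i _; rewrite EFinM -diracE.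
have muT : mu setT = 1%E.
  rewrite muE -[RHS]/(1%R%:E); congr EFin; rewrite -[RHS]m1.
  by apply: eq_bigr => i _; rewrite mem_set ?mulr1.
(* The mass is already 1; normalizing only supplies the structure of a probability. *)
exists (mnormalize mu (dirac (0 : R))) => B.
by rewrite /= /mnormalize muT onee_eq0/= invr1 mule1 muE.
Qed.

Definition cumulative (c : nat -> R) i := if i is j.+1 then c j else 0.

(* [c i] is the mass of the first [i.+1] atoms. *)
Lemma step_probability (n : nat) (x c : nat -> R) :
  (0 < n)%N -> 0 <= c 0%N -> (forall i, c i <= c i.+1) -> c n.-1 = 1 -> (forall i, 0 <= x i) ->
  exists G : probability R R, bid_dist G /\
    forall b k, (k <= n)%N -> (forall i, (i < n)%N -> (x i <= b) = (i < k)%N) ->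
      Defs.cdf G b = cumulative c k.
Proof.
move=> n0 c0 cS cn x0; pose m i := cumulative c i.+1 - cumulative c i.
have tele k : \sum_(i < k) m i = cumulative c k.
  by rewrite -(big_mkord predT m) telescope_sumr// subr0.
have [||G GE] := @discrete_probability n x m.
- by case=> [|i]; rewrite /m/= ?subr0// subr_ge0.
- by rewrite tele -(prednK n0).
exists G; split.
  rewrite /bid_dist GE -[RHS]/(1%R%:E); congr EFin.
  transitivity (\sum_(i < n) m i); last by rewrite tele -(prednK n0).
  by apply: eq_bigr => i _; rewrite mem_set ?mulr1/=.
move=> b k kn xb; rewrite /Defs.cdf GE/= -tele.
rewrite -(big_mkord predT m) -(big_mkord predT (fun i => m i * (x i \in [set y | y <= b])%:R)).
rewrite (big_cat_nat (leq0n k) kn)/= [X in _ + X]big_nat_cond [X in _ + X]big1 ?addr0.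
  rewrite big_nat_cond [RHS]big_nat_cond; apply: eq_bigr => i /andP[/andP[_ ik] _].
  by rewrite mem_set ?mulr1//= xb// (leq_trans ik).
move=> i /andP[/andP[ki i_n] _]; rewrite memNset ?mulr0//= => /[!xb]//.
by rewrite ltnNge ki.
Qed.

End DiscreteProbability.

(** * Lower bound for [0 < alpha < 1]: two distributions on 0 and 1/2 *)

Section LowerBoundSqrt.
Context (R : realType) (alpha : R).
Hypothesis a01 : 0 < alpha < 1.

(** The outcome bit is the competing bid, not the win: for [alpha > 0] the payment of a winning bid
    reveals it, so every bid is informative. *)
Let out (o : bool) (b : R) : R * R :=
  let d := if o then 0 else 1 / 2 in
  let x := if d <= b then 1 else 0 in (x, x * (alpha * d + (1 - alpha) * b)).

Let two_point (p : R) : 0 < p < 1 -> exists G : probability R R,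
  [/\ bid_dist G, G (~` [set 0; 1 / 2]) = 0%E, fine (G [set 0]) = p,
      forall b, 0 <= b < 1 / 2 -> Defs.cdf G b = p & forall b, 1 / 2 <= b -> Defs.cdf G b = 1].
Proof.
move=> /andP[p0 p1].
have [||G GE] := @discrete_probability R 2 (fun i => i%:R / 2) (fun i => if i is 0%N then p else 1 - p).
- by case=> [|i]; lra.
- by rewrite !big_ord_recl big_ord0/=; lra.
have {}GE B : G B = (p * (0 \in B)%:R + (1 - p) * (1 / 2 \in B)%:R)%:E.
  by rewrite GE !big_ord_recl big_ord0/= mul0r addr0.
exists G; split.
- by rewrite /bid_dist GE !mem_set/=; [congr EFin; lra|lra|lra].
- by rewrite GE !memNset/= ?mulr0 ?addr0//; apply; [right|left].
- by rewrite GE mem_set//= memNset/= ?mulr0 ?addr0 ?mulr1//; lra.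
- move=> b /andP[b0 b2]; rewrite /Defs.cdf GE mem_set//= memNset/= ?mulr0 ?addr0 ?mulr1//.
  by apply/negP; rewrite -ltNge.
- move=> b b2; rewrite /Defs.cdf GE !mem_set//=; first by lra.
  by lra.
Qed.

Let cdf_int_half (G : probability R R) p : 0 < p < 1 ->
  (forall b, 0 <= b < 1 / 2 -> Defs.cdf G b = p) -> (forall b, 1 / 2 <= b -> Defs.cdf G b = 1) ->
  cdf_int G (1 / 2) = p / 2.
Proof.
move=> /andP[p0 p1] Gp G1; apply/eqP; rewrite eq_le; apply/andP; split.
  (* The distribution function jumps at 1/2, so the rectangle bound is tight only on intervals
     ending before 1/2. *)
  apply/ler_addgt0Pr => e e0.
  pose e' := Num.min e (1 / 2).
  have e'e : e' <= e by rewrite ge_min lexx.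
  have e'2 : e' <= 1 / 2 by rewrite ge_min lexx orbT.
  have e'0 : 0 < e' by rewrite lt_min e0/=; lra.
  have h0 : 0 <= 1 / 2 - e' by lra.
  have /andP[_ +] := cdf_int_bounds G h0 (ltac:(lra) : 1 / 2 - e' <= 1 / 2).
  have := cdf_int_le G h0.
  rewrite (G1 _ (lexx _)) Gp; last by apply/andP; split; lra.
  have : 0 <= e' * p by rewrite mulr_ge0 ?ltW.
  lra.
have /andP[+ _] := cdf_int_bounds G (lexx 0) (ltac:(lra) : 0 <= 1 / 2).
rewrite Gp ?lexx/=; last lra.
by rewrite cdf_int0; lra.
Qed.

(** The tie: with mass [p] at 0 the bids 0 and 1/2 earn [p] and [1/2 + alpha * p / 2], which agree
    at this mass. *)
Let ps : R := (2 - alpha)^-1.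
Let q : R := 1 - ps.

Let ps_bounds : [/\ 1 / 2 <= ps, 0 < q, q <= 1 / 2 & ps * (2 - alpha) = 1].
Proof.
have /andP[al0 al1] := a01.
have h : ps * (2 - alpha) = 1 by rewrite /ps mulVf// gt_eqF//; lra.
have ps0 : 0 < ps by rewrite invr_gt0; lra.
by rewrite /q; split => //; nra.
Qed.

Let good (i : bool) (b : R) := if i then b < 1 / 2 else 1 / 2 <= b.

Let rew_two_point (i : bool) (delta : R) (G : probability R R) (p : R) :
  0 < p < 1 -> 0 <= delta -> p = (if i then ps + delta else ps - delta) ->
  (forall b, 0 <= b < 1 / 2 -> Defs.cdf G b = p) -> (forall b, 1 / 2 <= b -> Defs.cdf G b = 1) ->
  let base := if i then 1 / 2 + alpha * (p / 2) else p in
  let gap := delta * (2 - alpha) / 2 in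
  (forall b, 0 <= b -> rew G 1 b alpha <= base + gap * (good i b)%:R) /\
  exists2 b, 0 <= b & base + gap <= rew G 1 b alpha.
Proof.
move=> p01 d0 pE Gp G1 base gap.
have I2 := cdf_int_half p01 Gp G1.
have [ps2 q0 q2 psE] := ps_bounds.
have /andP[al0 al1] := a01; have /andP[p0 p1] := p01.
have lo b : 0 <= b -> b < 1 / 2 -> rew G 1 b alpha <= p.
  move=> b0 b2; rewrite rewE Gp ?b0//.
  have := cdf_int_le G b0; rewrite Gp ?b0// => h.
  have : alpha * cdf_int G b <= alpha * (b * p) by rewrite ler_wpM2l// ltW.
  have : 0 <= (1 - alpha) * (b * p) by rewrite mulr_ge0 ?mulr_ge0 ?subr_ge0// ltW.
  lra.
have hi b : 1 / 2 <= b -> rew G 1 b alpha <= 1 / 2 + alpha * (p / 2).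
  move=> b2; rewrite rewE G1//.
  have /andP[_] := cdf_int_bounds G (ltac:(lra) : 0 <= 1 / 2) b2; rewrite G1// I2 => h.
  have : alpha * (cdf_int G b - p / 2) <= alpha * ((b - 1 / 2) * 1) by rewrite ler_wpM2l// ltW.
  have : 0 <= (1 - alpha) * (b - 1 / 2) by rewrite mulr_ge0 ?subr_ge0// ltW.
  lra.
have gapE : p - (1 / 2 + alpha * (p / 2)) = if i then gap else - gap.
  by rewrite /gap pE; case: (i); lra.
split.
  move=> b b0; rewrite /base /good; case: ltP => b2; case: (i) gapE => gapE;
    rewrite ?mulr1 ?mulr0 ?addr0.
  - by apply: le_trans (lo b b0 b2) _; lra.
  - by apply: le_trans (lo b b0 b2) _; lra.
  - by apply: le_trans (hi b b2) _; lra.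
  - by apply: le_trans (hi b b2) _; lra.
move: gapE; rewrite /base; case: (i) => gapE.
  exists 0 => //; rewrite rewE Gp ?lexx/=; last lra.
  by rewrite cdf_int0; lra.
by exists (1 / 2); [lra|rewrite rewE G1// I2; lra].
Qed.

Lemma regret_lower_sqrt : exists c : R, 0 < c /\
  exists T0 : nat, forall T : nat, (T0 <= T)%N ->
  forall A : bandit_alg R, alg_valid A ->
  exists F G : probability R R, value_dist F /\ bid_dist G /\
    ((c * (T%:R `^ (1 / 2)))%:E <= regret alpha F G A T)%E.
Proof.
have [ps2 q0 q2 psE] := ps_bounds.
have /andP[al0 al1] := a01.
(* Chosen so that the entropy term [7 * T ^ 2 * kappa / 2] equals [T / 8]; the good bids then number
   at most [T / 2 + T / 8 + T / 8] under some hypothesis. *)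
pose s := Num.sqrt (q / 7) / 8.
have s0 : 0 < s by rewrite divr_gt0// sqrtr_gt0 divr_gt0.
have sE : s ^+ 2 = q / 7 / 64.
  by rewrite expr_div_n sqr_sqrtr ?divr_ge0 ?(ltW q0)//; congr (_ / _); ring.
exists (s / 8); split; first by rewrite divr_gt0.
(* Such [T] satisfy [q * T >= 1], hence [delta <= q / 2], which keeps [ps + delta] away from 1. *)
exists (Num.truncn q^-1).+1 => T TT0 A Av.
have T0 : (0 < T)%N by exact: leq_trans TT0.
have T0' : 0 < T%:R :> R by rewrite ltr0n.
have qT : 1 <= q * T%:R.
  rewrite -[leLHS](mulfV (lt0r_neq0 q0)) ler_pM2l//; apply: ltW.
  by apply: lt_le_trans (Num.Theory.truncnS_gt _) _; rewrite ler_nat.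
have A0 t (h : t.-tuple (round_info R)) u v : 0 <= A t h u v.
  by have [] := Av t.
pose r := Num.sqrt (T%:R : R).
have r0 : 0 < r by rewrite sqrtr_gt0.
have rE : r ^+ 2 = T%:R by rewrite sqr_sqrtr// ltW.
have -> : T%:R `^ (1 / 2) = r by rewrite div1r powR12_sqrt// ltW.
pose delta := s / r.
have d0 : 0 < delta by rewrite divr_gt0.
have dE : delta ^+ 2 * T%:R = q / 7 / 64 by rewrite exprMn exprVn rE sE; field; rewrite gt_eqF.
have dq : delta <= q / 2.
  have : delta ^+ 2 * T%:R <= (q / 2) ^+ 2 * T%:R by rewrite dE; nra.
  by rewrite ler_pM2r// ler_pXn2r// nnegrE; lra.
pose p (i : bool) := if i then ps + delta else ps - delta.
have p01 i : 0 < p i < 1 by rewrite /p; case: i; apply/andP; split; move: dq; rewrite /q; lra.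
pose G i := proj1_sig (cid (two_point (p01 i))).
have GP i : [/\ bid_dist (G i), G i (~` [set 0; 1 / 2]) = 0%E, fine (G i [set 0]) = p i,
      forall b, 0 <= b < 1 / 2 -> Defs.cdf (G i) b = p i & forall b, 1 / 2 <= b -> Defs.cdf (G i) b = 1].
  by rewrite /G; case: cid.
pose kappa := 16 * delta ^+ 2 / q.
have [i Hi] : exists i : bool, hits A out (good i) (fun=> fine (G i [set 0])) T [tuple] <=
   T%:R / #|{: bool}|%:R + T%:R / 8 + 7 * T%:R ^+ 2 * kappa / #|{: bool}|%:R.
  apply: (@exists_hits_le R bool A good (fun=> ps) (fun i _ => fine (G i [set 0])) out kappa) => //.
  - by move=> b [] [] _ //; rewrite /good => h1 h2; exfalso; lra.
  - by move=> i b; have [_ _ -> _ _] := GP i; have /andP[/ltW -> /ltW ->] := p01 i.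
  - move=> b b0; right; split.
    + by move: dq; rewrite /q; lra.
    + by move=> i; have [_ _ -> _ _] := GP i.
    + have H i : (ps - fine (G i [set 0])) ^+ 2 / (fine (G i [set 0]) * (1 - fine (G i [set 0]))) <= kappa / 2.
        have [_ _ -> _ _] := GP i.
        have -> : (ps - p i) ^+ 2 = delta ^+ 2 by rewrite /p; case: (i); ring.
        have pq : q / 8 <= p i * (1 - p i).
          by rewrite /p; case: (i); move: dq; rewrite /q; nra.
        have pq0 : 0 < p i * (1 - p i) by apply: lt_le_trans pq; lra.
        rewrite ler_pdivrMr// /kappa.
        have -> : 16 * delta ^+ 2 / q / 2 * (p i * (1 - p i)) = delta ^+ 2 * (8 / q * (p i * (1 - p i))) by field; rewrite gt_eqF.
        rewrite ler_peMr ?sqr_ge0//.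
        move: pq; set X := _ * (1 - _) => pq.
        have -> : 8 / q * X = (8 * X) / q by ring.
        by rewrite ler_pdivlMr//; lra.
      apply: (@le_trans _ _ (\sum_(i : bool) kappa / 2)); first exact: ler_sum.
      by rewrite sumr_const card_bool -[leLHS]mulr_natr divfK.
  - by apply: divr_ge0; [apply: mulr_ge0; [lra|exact: sqr_ge0]|exact: ltW].
  - by rewrite card_bool.
have [GB GE Gp Glo Ghi] := GP i.
exists (dirac (1%R : R)), (G i); split; [exact: value_dist_dirac1|split => //].
have [Hr [b b0 Hb]] := rew_two_point (p01 i) (ltW d0) erefl Glo Ghi.
have mset1 (x : R) : measurable [set x] by exact: measurable_set1.
have outE (b' d : R) : 0 <= b' -> [set 0; 1 / 2] d ->
    let x : R := if d <= b' then 1 else 0 in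
    (x, x * (alpha * d + (1 - alpha) * b')) = out (d \in [set 0]) b'.
  move=> _ [->|->]; first by rewrite mem_set.
  by rewrite memNset//=; lra.
have base0 : 0 <= (if i then 1 / 2 + alpha * (p i / 2) else p i).
  have /andP[pi0 _] := p01 i; have := mulr_ge0 (ltW al0) (ltW pi0).
  by case: (i) pi0; lra.
have gap0 : 0 <= delta * (2 - alpha) / 2.
  by apply: divr_ge0 => //; apply: mulr_ge0; [exact: ltW|lra].
have Hreg := @regret_ge_hits R A alpha (G i) _ (fun=> [set 0]) out (good i) _ _
  A0 (measurableU _ _ (mset1 0) (mset1 (1 / 2))) GE (fun=> mset1 0) outE base0 gap0 Hr T b
  (ltac:(apply/andP; split; exact: ltW)) b0 Hb.
apply: le_trans Hreg.
rewrite lee_fin Gp.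
move: Hi; rewrite Gp card_bool.
have -> : 7 * T%:R ^+ 2 * kappa / 2 = 7 * 16 / 2 * (delta ^+ 2 * T%:R) * T%:R / q.
  by rewrite /kappa; field; rewrite gt_eqF.
rewrite dE; have -> : 7 * 16 / 2 * (q / 7 / 64) * T%:R / q = T%:R / 8 by field; rewrite gt_eqF.
move=> Hh; have {}Hh : T%:R / 4 <= T%:R - hits A out (good i) (fun=> p i) T [tuple] by lra.
apply: (@le_trans _ _ (delta * (2 - alpha) / 2 * (T%:R / 4))); last first.
  rewrite ler_wpM2l// divr_ge0 ?mulr_ge0 ?ltW//; lra.
rewrite -rE /delta.
have -> : s / r * (2 - alpha) / 2 * (r ^+ 2 / 4) = s / 8 * r * (2 - alpha) by field; rewrite gt_eqF.
rewrite ler_peMr//; last lra.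
by rewrite mulr_ge0 ?divr_ge0// ltW.
Qed.

End LowerBoundSqrt.

(** * Lower bound for [alpha = 0]: a hidden needle *)

Section LowerBoundTwoThirds.
Context (R : realType).

Section Needle.
Context (K : nat) (delta : R).
Hypotheses (K0 : (0 < K)%N) (d0 : 0 <= delta) (dK : delta * (8 * K%:R) <= 1).

Let K0' : 0 < K%:R :> R. Proof. by rewrite ltr0n. Qed.

Let atom (i : nat) : R := if (i < K)%N then i%:R / (2 * K%:R) else 1.

(* With these masses every atom gives the same first-price reward
   (1 - atom i) * mass i = 1/4. *)
Let flat (i : nat) : R := (4 * (1 - atom i))^-1.

(** Cumulative masses. Raising the one at [j] moves mass [delta] from the next atom to atom [j], so
    the distribution function changes on a single interval of bids. *)
Let mass (j i : nat) : R := if (i < K)%N then flat i + delta * (i == j)%:R else 1.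

Let idx (b : R) : nat := minn (Num.truncn (b * (2 * K%:R))) K.-1.

Let atom_lt i : (i < K)%N -> 0 <= atom i <= 1 / 2.
Proof.
move=> iK; rewrite /atom iK divr_ge0//= ler_pdivrMr ?mulr_gt0//.
by rewrite mulrA div1r mulVf// mul1r ler_nat ltnW.
Qed.

Let flat_bounds i : (i < K)%N -> 1 / 4 <= flat i <= 1 / 2.
Proof.
move=> iK; have /andP[a0 a2] := atom_lt iK.
have h : flat i * (1 - atom i) = 1 / 4.
  by rewrite /flat; field; rewrite gt_eqF//; lra.
have f0 : 0 < flat i by rewrite /flat invr_gt0; lra.
apply/andP; split; nra.
Qed.

Let flatE i : (i < K)%N -> flat i * (1 - atom i) = 1 / 4.
Proof.
by move=> iK; have /andP[a0 a2] := atom_lt iK; rewrite /flat; field; rewrite gt_eqF//; lra.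
Qed.

Let delta_le : delta <= 1 / 8.
Proof.
have : 0 <= delta * (K%:R - 1) by rewrite mulr_ge0// subr_ge0 ler1n.
have := dK; lra.
Qed.

(** Consecutive values of [flat] differ by at least [1 / (8 * K)], which leaves room for a bump of
    height [delta]. *)
Let mass_nondecreasing j i : mass j i <= mass j i.+1.
Proof.
rewrite /mass; case: (ltnP i.+1 K) => iK1; last first.
  case: ifP => // iK; have /andP[_ f2] := flat_bounds iK.
  case: (i == j); rewrite ?mulr1 ?mulr0; have := delta_le; lra.
have iK : (i < K)%N by exact: ltnW.
rewrite iK.
have /andP[a0 a2] := atom_lt iK; have /andP[b0 b2] := atom_lt iK1.
have h : atom i.+1 - atom i = (2 * K%:R)^-1.
  by rewrite /atom iK iK1 -natr1; field; rewrite gt_eqF.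
have h2 : delta <= (2 * K%:R)^-1 / 4.
  by rewrite -invfM -[leRHS]div1r ler_pdivlMr ?mulr_gt0//; have := dK; lra.
have /andP[f1 f2] := flat_bounds iK; have /andP[g1 g2] := flat_bounds iK1.
have e1 := flatE iK; have e2 := flatE iK1.
have : flat i.+1 - flat i = 4 * (flat i * flat i.+1) * (atom i.+1 - atom i).
  have -> : 4 * (flat i * flat i.+1) * (atom i.+1 - atom i) =
    4 * (flat i.+1 * (flat i * (1 - atom i)) - flat i * (flat i.+1 * (1 - atom i.+1))) by ring.
  by rewrite e1 e2; lra.
have : 0 <= (flat i * flat i.+1 - 1 / 16) * (atom i.+1 - atom i).
  by rewrite mulr_ge0//; [nra|rewrite h invr_ge0 mulr_ge0].
have : delta * (i == j)%:R <= delta by rewrite ler_piMr// lern1 leq_b1.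
have : 0 <= delta * (i.+1 == j)%:R by rewrite mulr_ge0.
rewrite h; lra.
Qed.

Let atom_ge0 i : 0 <= atom i.
Proof. by rewrite /atom; case: ifP. Qed.

Let idx_lt b : (idx b < K)%N.
Proof. by rewrite /idx (leq_ltn_trans (geq_minr _ _))// prednK. Qed.

Let atom_le_idx b i : 0 <= b -> (i < K)%N -> (atom i <= b) = (i <= idx b)%N.
Proof.
move=> b0 iK; rewrite /atom iK ler_pdivrMr ?mulr_gt0// /idx leq_min.
rewrite Num.Theory.truncn_ge_nat ?mulr_ge0//.
by rewrite -[X in _ && X]ltnS prednK// iK andbT.
Qed.

Let needle (j : nat) : exists G : probability R R, bid_dist G /\
  forall b, 0 <= b -> Defs.cdf G b = if b < 1 then mass j (idx b) else 1.
Proof.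
have [||||//|G [Gd GE]] := @step_probability R K.+1 atom (mass j).
- by [].
- rewrite /mass K0; have /andP[f0 _] := flat_bounds K0.
  by rewrite addr_ge0 ?mulr_ge0//; lra.
- exact: mass_nondecreasing.
- by rewrite /mass ltnn.
exists G; split => // b b0; case: ltP => b1.
  rewrite (GE b (idx b).+1)//=.
    by rewrite ltnS ltnW.
  move=> i; rewrite ltnS leq_eqVlt => /predU1P[->|iK]; last by rewrite atom_le_idx.
  rewrite {1}/atom ltnn leNgt b1/=; apply/esym/negbTE.
  by rewrite -leqNgt.
rewrite (GE b K.+1)//=; first by rewrite /mass ltnn.
move=> i iK; rewrite iK; apply: le_trans b1.
by rewrite /atom; case: ifP => // /atom_lt; rewrite /atom; case: ifP => //; lra.
Qed.

Let good (j : nat) (b : R) := (b < 1) && (idx b == j).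

Let rew_needle j (G : probability R R) : (j < K)%N ->
  (forall b, 0 <= b -> Defs.cdf G b = if b < 1 then mass j (idx b) else 1) ->
  (forall b, 0 <= b -> rew G 1 b 0 <= 1 / 4 + delta * (1 - atom j) * (good j b)%:R) /\
  1 / 4 + delta * (1 - atom j) <= rew G 1 (atom j) 0.
Proof.
move=> jK GE; split=> [b b0|]; rewrite rewE mul0r addr0 GE//.
  have d0' := d0; rewrite /good; case: ltP => b1 /=; last by rewrite mulr1 mulr0; lra.
  set k := idx b; have kK : (k < K)%N by exact: idx_lt.
  have kb : atom k <= b by rewrite atom_le_idx.
  rewrite /mass kK; have e := flatE kK.
  have /andP[f0 _] := flat_bounds kK.
  have : (1 - b) * flat k <= 1 / 4 by nra.
  case: eqP => [<-|_]; rewrite ?mulr1 ?mulr0 ?addr0; nra.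
have /andP[a0 a2] := atom_lt jK.
have -> : atom j < 1 by lra.
have -> : idx (atom j) = j.
  rewrite /idx /atom jK divfK ?Num.Theory.natrK; last by rewrite gt_eqF// mulr_gt0.
  by apply/minn_idPl; rewrite -ltnS prednK.
rewrite /mass jK eqxx mulr1; have := flatE jK; lra.
Qed.

Lemma regret_needle (T : nat) (A : bandit_alg R) : alg_valid A ->
  K%:R >= 4 :> R -> T%:R <= K%:R ^+ 3 :> R -> delta * (20 * K%:R) = 1 ->
  exists G : probability R R, bid_dist G /\
    ((delta * T%:R / 4)%:E <= regret 0 (dirac (1%R : R)) G A T)%E.
Proof.
move=> Av K4 TK dE; have d0' := d0.
have A0 t (h : t.-tuple (round_info R)) u v : 0 <= A t h u v by have [] := Av t.
pose G j := proj1_sig (cid (needle j)).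
have GP j : bid_dist (G j) /\
  forall b, 0 <= b -> Defs.cdf (G j) b = if b < 1 then mass j (idx b) else 1.
  by rewrite /G; case: cid.
pose P (j : 'I_K) b := fine (G j [set y | y <= b]).
have PE (j : 'I_K) b : 0 <= b -> P j b = if b < 1 then mass j (idx b) else 1.
  by move=> b0; rewrite -(GP j).2.
pose P0 b : R := if b < 1 then flat (idx b) else 1.
pose out (o : bool) (b : R) : R * R := if o then (1, b) else (0, 0).
(* Only the needle in the interval of the bid differs from the reference there, and masses [m]
   between 1/4 and 3/4 satisfy [m * (1 - m) >= 1/6]. *)
pose kappa := 6 * delta ^+ 2.
have massE j b : mass j (idx b) = flat (idx b) + delta * (idx b == j)%:R.
  by rewrite /mass idx_lt.
have mass01 j b : 1 / 4 <= mass j (idx b) <= 3 / 4.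
  rewrite massE; have /andP[f1 f2] := flat_bounds (idx_lt b); have := delta_le.
  by case: eqP => _; rewrite ?mulr1 ?mulr0 => ?; apply/andP; split; lra.
have [j Hj] : exists j : 'I_K, hits A out (good j) (P j) T [tuple] <=
   T%:R / #|'I_K|%:R + T%:R / 8 + 7 * T%:R ^+ 2 * kappa / #|'I_K|%:R.
  apply: (@exists_hits_le R 'I_K A (fun j => good j) P0 P out kappa) => //.
  - by move=> b i j _ /andP[_ /eqP ib] /andP[_ /eqP jb]; apply: val_inj; rewrite /= -ib -jb.
  - by move=> i b; rewrite -[P i b]/(Defs.cdf (G i) b) cdf_ge0 cdf_le1.
  - move=> b b0; rewrite /P0; have [b1|b1] := ltP b 1; [right|left].
      have /andP[f1 f2] := flat_bounds (idx_lt b).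
      split.
      + by apply/andP; split; lra.
      + by move=> i; rewrite PE// b1; have /andP[m1 m2] := mass01 i b; apply/andP; split; lra.
      + have [k kE] : exists k : 'I_K, nat_of_ord k = idx b by exists (Ordinal (idx_lt b)).
        rewrite (bigD1 k)//= big1 ?addr0.
          rewrite PE// b1 massE kE eqxx mulr1.
          have := mass01 k b; rewrite massE kE eqxx mulr1; set m := _ + _ => /andP[m1 m2].
          rewrite ler_pdivrMr; last by nra.
          rewrite /kappa (_ : flat (idx b) - m = - delta) ?sqrrN; last by rewrite /m; ring.
          have : 0 <= delta ^+ 2 * (6 * (m * (1 - m)) - 1) by rewrite mulr_ge0 ?sqr_ge0//; nra.
          lra.
        move=> i ik; rewrite PE// b1 massE -kE.
        by rewrite (_ : _ == _ = false) ?mulr0 ?addr0 ?subrr ?expr0n ?mul0r// eq_sym; apply/negbTE.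
    by split => // i; rewrite PE// ltNge b1.
  - by rewrite /kappa mulr_ge0 ?sqr_ge0.
  - by rewrite card_ord.
exists (G j); have [Gd GE] := GP j; split=> //.
have [Hr Hb] := rew_needle (ltn_ord j) GE.
have /andP[a0 a2] := atom_lt (ltn_ord j).
have mle (b : R) : measurable [set y : R | y <= b] by rewrite -set_itvNyc; exact: measurable_itv.
have outE (b d : R) : 0 <= b -> setT d ->
    let x : R := if d <= b then 1 else 0 in
    (x, x * (0 * d + (1 - 0) * b)) = out (d \in [set y | y <= b]) b.
  move=> _ _; case: ifPn => db; first by rewrite mem_set//= /out mul0r add0r subr0 !mul1r.
  by rewrite memNset; [rewrite /= mul0r|exact/negP].
have gap0 : 0 <= delta * (1 - atom j) by rewrite mulr_ge0//; lra.
have GC : G j (~` setT) = 0%E by rewrite setCT measure0.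
have Hreg := @regret_ge_hits R A 0 (G j) setT (fun b => [set y | y <= b]) out (good j) _ _
  A0 measurableT GC mle outE (ltac:(lra) : 0 <= 1 / 4) gap0 Hr T (atom j)
  (ltac:(by rewrite lexx ler01)) a0 Hb.
apply: le_trans Hreg; rewrite lee_fin.
move: Hj; rewrite card_ord -/(P j) => Hj.
have T0 : 0 <= T%:R :> R by [].
(* The three terms are at most [T / 4], [T / 8] and [21 * T / 200], together below [T / 2]. *)
have h1 : T%:R / K%:R <= T%:R / 4 :> R by rewrite ler_wpM2l// lef_pV2 ?posrE.
have h2 : 7 * T%:R ^+ 2 * kappa / K%:R <= T%:R * (21 / 200).
  rewrite ler_pdivrMr// /kappa.
  have -> : 7 * T%:R ^+ 2 * (6 * delta ^+ 2) = T%:R * (21 / 200) * (T%:R * (20 * delta) ^+ 2) by field.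
  rewrite ler_wpM2l ?mulr_ge0//.
  have dK1 : 20 * delta * K%:R = 1 by rewrite -[RHS]dE; ring.
  have -> : K%:R = (20 * delta * K%:R) ^+ 2 * K%:R by rewrite dK1 expr1n mul1r.
  have -> : (20 * delta * K%:R) ^+ 2 * K%:R = K%:R ^+ 3 * (20 * delta) ^+ 2 by ring.
  by rewrite ler_wpM2r ?sqr_ge0.
have : T%:R / 2 * delta <= delta * (T%:R - hits A out (good j) (P j) T [tuple]).
  by rewrite mulrC ler_wpM2l//; lra.
have -> : delta * (1 - atom j) * (T%:R - hits A out (good j) (P j) T [tuple]) =
  (1 - atom j) * (delta * (T%:R - hits A out (good j) (P j) T [tuple])) by ring.
move: (delta * (_ - _)) => z hz.
have dT : 0 <= T%:R * delta by rewrite mulr_ge0.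
have : 0 <= (1 / 2 - atom j) * z by rewrite mulr_ge0//; lra.
lra.
Qed.

End Needle.

Lemma regret_lower_two_thirds : exists c : R, 0 < c /\
  exists T0 : nat, forall T : nat, (T0 <= T)%N ->
  forall A : bandit_alg R, alg_valid A ->
  exists F G : probability R R, value_dist F /\ bid_dist G /\
    ((c * (T%:R `^ (2 / 3)))%:E <= regret 0 F G A T)%E.
Proof.
(* [160 = 20 * 4 * 2]: the regret is [delta * T / 4] with [delta = 1 / (20 * K)] and
   [K <= 2 * T^(1/3)]. Below, [64 = 4 ^ 3] ensures [K >= 4]. *)
exists (1 / 160); split; first by rewrite divr_gt0.
exists 64%N => T T64 A Av.
have T0 : 0 < T%:R :> R by rewrite ltr0n (leq_trans _ T64).
pose r : R := T%:R `^ (1 / 3).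
have r0 : 0 < r by rewrite powR_gt0.
have r3 : r ^+ 3 = T%:R.
  by rewrite -powR_mulrn ?ltW// /r -powRrM (_ : 1 / 3 * 3%:R = 1) ?powRr1 ?ltW//; field.
have r2 : T%:R `^ (2 / 3) = r ^+ 2.
  by rewrite -[RHS]powR_mulrn ?ltW// /r -powRrM; congr (_ `^ _); field.
have r4 : 4 <= r.
  rewrite leNgt; apply/negP => r4.
  have : r ^+ 3 < 4 ^+ 3 by rewrite ltrXn2r// ltW.
  rewrite r3 -natrX ltr_nat ltnNge; exact/negP/negPn.
pose K := (Num.truncn r).+1.
have rK : r <= K%:R by apply: ltW; exact: Num.Theory.truncnS_gt.
have Kr : K%:R <= 2 * r.
  have : (Num.truncn r)%:R <= r by rewrite Num.Theory.truncn_le ltW.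
  by rewrite /K -natr1; lra.
have K0 : 0 < K%:R :> R by rewrite ltr0n.
pose delta : R := (20 * K%:R)^-1.
have d0 : 0 < delta by rewrite invr_gt0 mulr_gt0.
have dE : delta * (20 * K%:R) = 1 by rewrite mulVf// gt_eqF// mulr_gt0.
have dK : delta * (8 * K%:R) <= 1.
  have := mulr_ge0 (ltW d0) (ltW K0); lra.
have K4 : 4 <= K%:R :> R by lra.
have TK : T%:R <= K%:R ^+ 3 :> R by rewrite -r3 lerXn2r// nnegrE ltW.
have [G [Gd Greg]] := regret_needle (ltn0Sn _) (ltW d0) dK Av K4 TK dE.
exists (dirac (1%R : R)), G; split; first exact: value_dist_dirac1.
split => //; apply: le_trans Greg; rewrite lee_fin r2 -r3.
have -> : 1 / 160 * r ^+ 2 = (delta * (20 * K%:R)) * (1 / 160 * r ^+ 2) by rewrite dE [RHS]mul1r.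
have -> : (delta * (20 * K%:R)) * (1 / 160 * r ^+ 2) = delta * r ^+ 2 / 4 * (K%:R / 2) by field.
have -> : delta * r ^+ 3 / 4 = delta * r ^+ 2 / 4 * r by ring.
apply: ler_wpM2l; last lra.
by apply: divr_ge0 => //; apply: mulr_ge0; [exact: ltW|exact: sqr_ge0].
Qed.

End LowerBoundTwoThirds.

(** * Strategies on a grid *)

Section DiscreteStates.
Context d (Z : measurableType d).

(** For countable [S] this is measurability into the discrete sigma-algebra, stated by fibers so
    that [S] needs none. *)
Definition cmeasurable (S : Type) (f : Z -> S) := forall s, measurable [set z | f z = s].

Lemma cmeasurable_cst (S : choiceType) (s : S) : cmeasurable (fun=> s).
Proof.
move=> s'; have [->|ss] := eqVneq s s'.
  by rewrite (_ : [set _ | _] = setT)//; apply/seteqP; split.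
rewrite (_ : [set _ | _] = set0)//; apply/seteqP; split => // z /= H.
by move: ss; rewrite H eqxx.
Qed.

Lemma measurable_countable_cover (S : countType) (f : Z -> S) (B : S -> set Z) :
  cmeasurable f -> (forall s, measurable (B s)) -> measurable [set z | B (f z) z].
Proof.
move=> mf mB.
rewrite (_ : [set _ | _] =
  \bigcup_n (if unpickle n is Some s then [set z | f z = s] `&` B s else set0)).
  apply: bigcupT_measurable => n; case: unpickle => // s.
  by apply: measurableI; [exact: mf|exact: mB].
apply/seteqP; split=> z /=.
  by move=> Bz; exists (pickle (f z)) => //; rewrite pickleK.
by move=> [n _]; case: unpickle => // s [<-].
Qed.

Lemma cmeasurable_bind (S : countType) (S' : Type) (f : Z -> S) (g : S -> Z -> S') :
  cmeasurable f -> (forall s, cmeasurable (g s)) -> cmeasurable (fun z => g (f z) z).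
Proof.
move=> mf mg s'.
exact: (@measurable_countable_cover S f (fun s => [set z | g s z = s']) mf (fun s => mg s s')).
Qed.

Lemma cmeasurable_comp (S : countType) (S' : choiceType) (f : Z -> S) (g : S -> S') :
  cmeasurable f -> cmeasurable (g \o f).
Proof.
move=> mf; apply: (@cmeasurable_bind S S' f (fun s _ => g s) mf) => s.
exact: cmeasurable_cst.
Qed.

Lemma cmeasurable_measurable_fun d' (Y : measurableType d') (S : countType) (f : Z -> S) (phi : S -> Y) :
  cmeasurable f -> measurable_fun setT (phi \o f).
Proof.
move=> mf _ B mB; rewrite setTI.
apply: (@measurable_countable_cover S f (fun s => [set _ | B (phi s)]) mf) => s.
have [Bs|nBs] := pselect (B (phi s)).
  by rewrite (_ : [set _ | _] = setT)//; apply/seteqP; split.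
by rewrite (_ : [set _ | _] = set0)//; apply/seteqP; split.
Qed.

End DiscreteStates.

Lemma cmeasurable_precomp d d' (Z : measurableType d) (Y : measurableType d') (S : Type)
  (f : Y -> S) (h : Z -> Y) : measurable_fun setT h -> cmeasurable f -> cmeasurable (f \o h).
Proof. by move=> mh mf s; have := mh measurableT _ (mf s); rewrite setTI. Qed.

(** * Grid, observations and replayed states *)

Section Discretization.
Context (R : realType) (K : nat) (K0 : (0 < K)%N) (alpha : R).

Definition grid (l : nat) : R := l%:R / K%:R.

(* Index of the smallest grid point above [x], or [K.+1] if there is none. *)
Definition cell (x : R) : nat := find (fun l => x <= grid l) (iota 0 K.+1).

Lemma grid_le a b : (grid a <= grid b) = (a <= b)%N.
Proof. by rewrite /grid ler_pM2r ?invr_gt0 ?ltr0n// ler_nat. Qed.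

Lemma grid_ge0 l : 0 <= grid l.
Proof. by rewrite /grid divr_ge0. Qed.

Lemma grid0 : grid 0 = 0.
Proof. by rewrite /grid mul0r. Qed.

Lemma grid_le1 l : (l <= K)%N -> grid l <= 1.
Proof. by move=> lK; rewrite /grid ler_pdivrMr ?ltr0n// mul1r ler_nat. Qed.

Lemma gridS l : grid l.+1 = grid l + K%:R^-1.
Proof. by rewrite /grid -natr1 mulrDl mul1r. Qed.

Lemma cell_le_size x : (cell x <= K.+1)%N.
Proof. by rewrite /cell -[X in (_ <= X)%N](size_iota 0 K.+1) find_size. Qed.

Lemma cell_le x l : (l <= K)%N -> (cell x <= l)%N = (x <= grid l).
Proof.
move=> lK; apply/idP/idP => [xl|xl].
  have cK : (cell x < K.+1)%N by rewrite ltnS (leq_trans xl).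
  have : has (fun l => x <= grid l) (iota 0 K.+1) by rewrite has_find size_iota.
  move=> /(nth_find 0%N); rewrite nth_iota// add0n => /le_trans; apply.
  by rewrite grid_le.
rewrite leqNgt; apply/negP => lx.
have := before_find 0%N lx; rewrite nth_iota//= add0n.
by rewrite xl.
Qed.

Lemma cell_bounds x : 0 <= x <= 1 ->
  [/\ (cell x <= K)%N, x <= grid (cell x) & grid (cell x) <= x + K%:R^-1].
Proof.
move=> /andP[x0 x1].
have cK : (cell x <= K)%N by rewrite cell_le// /grid divff// pnatr_eq0 -lt0n.
split => //; first by rewrite -cell_le.
case E : (cell x) => [|l]; first by rewrite /grid mul0r addr_ge0// invr_ge0.
rewrite gridS lerD2r ltW// ltNge -cell_le; last by rewrite ltnW// -E.
by rewrite E ltnn.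
Qed.

Lemma cmeasurable_cell : @cmeasurable _ R _ cell.
Proof.
have H n : measurable [set x : R | (cell x <= n)%N].
  have [nK|Kn] := leqP n K.
    rewrite (_ : [set _ | _] = [set x | x <= grid n]); last first.
      by apply/seteqP; split => x /=; rewrite cell_le.
    by rewrite -set_itvNyc; exact: measurable_itv.
  rewrite (_ : [set _ | _] = setT)//; apply/seteqP; split => // x _ /=.
  exact: leq_trans (cell_le_size x) Kn.
case=> [|n].
  by rewrite (_ : [set _ | _] = [set x | (cell x <= 0)%N])//;
    apply/seteqP; split => x /=; rewrite leqn0 => /eqP.
rewrite (_ : [set _ | _] = [set x | (cell x <= n.+1)%N] `\` [set x | (cell x <= n)%N]).
  exact: measurableD.
apply/seteqP; split => x /=; first by move=> ->; rewrite leqnn ltnn.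
by move=> [h1 /negP]; rewrite -ltnNge => h2; apply/eqP; rewrite eqn_leq h1.
Qed.

(* For [alpha = 0] the feedback reveals the outcome only; the junk value
   [_ / 0 = 0] then makes a win look like the cell 0. *)
Definition observe (k : nat) (x c : R) : nat :=
  if x == 0 then k.+1 else minn (cell ((c - (1 - alpha) * grid k) / alpha)) k.+1.

(* One triple per past round: value cell, bid index, observed cell. *)
Definition state := seq (nat * nat * nat).

Context (pol : state -> nat -> nat).

(** Past bids are not part of the history; as the policy is deterministic, replaying it recovers
    them. *)
Definition update (s : state) (r : round_info R) : state :=
  let i := cell r.2.1.1 in
  let k := pol s i in
  rcons s (i, k, observe k r.2.1.2 r.2.2).

Definition state_of (h : seq (round_info R)) : state := foldl update [::] h.

Definition grid_alg : bandit_alg R := fun t h u v => grid (pol (state_of h) (cell v)).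

Lemma state_of_rcons h r : state_of (rcons h r) = update (state_of h) r.
Proof. by rewrite /state_of foldl_rcons. Qed.

Lemma size_state_of h : size (state_of h) = size h.
Proof.
elim/last_ind: h => // h r IH.
by rewrite state_of_rcons /update !size_rcons IH.
Qed.

Lemma cmeasurable_update s : cmeasurable (update s).
Proof.
have mv : measurable_fun setT (fun r : round_info R => r.2.1.1) by do 2! apply: measurableT_comp => //.
have mx : measurable_fun setT (fun r : round_info R => r.2.1.2) by do 2! apply: measurableT_comp => //.
have mc : measurable_fun setT (fun r : round_info R => r.2.2) by apply: measurableT_comp.
apply: (@cmeasurable_bind _ _ nat _ (fun r : round_info R => cell r.2.1.1)
  (fun i r => rcons s (i, pol s i, observe (pol s i) r.2.1.2 r.2.2))).
  exact: (cmeasurable_precomp mv cmeasurable_cell).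
move=> i; set k := pol s i.
apply: (@cmeasurable_comp _ _ nat _ (fun r : round_info R => observe k r.2.1.2 r.2.2)
  (fun o => rcons s (i, k, o))).
apply: (@cmeasurable_bind _ _ bool _ (fun r : round_info R => r.2.1.2 == 0) (fun b r =>
  if b then k.+1 else minn (cell ((r.2.2 - (1 - alpha) * grid k) / alpha)) k.+1)).
  have m0 : measurable [set r : round_info R | r.2.1.2 == 0].
    have := mx measurableT _ (measurable_set1 0); rewrite setTI.
    by rewrite (_ : _ @^-1` _ = [set r : round_info R | r.2.1.2 == 0])//;
      apply/seteqP; split => r /= /eqP.
  case; first exact: m0.
  rewrite (_ : [set _ | _] = ~` [set r : round_info R | r.2.1.2 == 0]); first exact: measurableC.
  by apply/seteqP; split => r /=; [move=> ->|move=> /negP/negbTE].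
case; first exact: cmeasurable_cst.
apply: (@cmeasurable_comp _ _ nat _
  (fun r : round_info R => cell ((r.2.2 - (1 - alpha) * grid k) / alpha)) (fun o => minn o k.+1)).
apply: (cmeasurable_precomp _ cmeasurable_cell).
by apply: measurable_funM => //; apply: measurable_funB.
Qed.

Lemma cmeasurable_state_of t : cmeasurable (fun h : t.-tuple (round_info R) => state_of h).
Proof.
have H n : (n <= t)%N -> cmeasurable (fun h : t.-tuple (round_info R) => state_of (take n h)).
  elim: n => [|n IH] nt.
    rewrite (_ : (fun h : t.-tuple _ => _) = (fun=> [::])); first exact: cmeasurable_cst.
    by apply/funext => h; rewrite take0.
  rewrite (_ : (fun h : t.-tuple _ => _) =
    (fun h : t.-tuple (round_info R) => update (state_of (take n h)) (tnth h (Ordinal nt)))).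
    apply: (@cmeasurable_bind _ _ state state
      (fun h : t.-tuple (round_info R) => state_of (take n h))
      (fun s h => update s (tnth h (Ordinal nt))) (IH (ltnW nt))) => s.
    exact: (cmeasurable_precomp (measurable_tnth _) (cmeasurable_update s)).
  apply/funext => h.
  rewrite (take_nth (tnth h (Ordinal nt))) ?size_tuple// state_of_rcons; congr update.
  by rewrite [RHS](tnth_nth (tnth h (Ordinal nt))).
have := H t (leqnn t); congr cmeasurable; apply/funext => h.
by rewrite take_oversize// size_tuple.
Qed.

Lemma alg_valid_grid_alg : alg_valid grid_alg.
Proof.
move=> t; split => [h u v|]; first exact: grid_ge0.
apply: (@cmeasurable_measurable_fun _ _ _ R nat (fun z : t.-tuple (round_info R) * R * R =>
  pol (state_of z.1.1) (cell z.2)) grid).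
apply: (@cmeasurable_bind _ _ state _ (fun z : t.-tuple (round_info R) * R * R => state_of z.1.1)
  (fun s z => pol s (cell z.2))).
  have m1 : measurable_fun setT (fun z : t.-tuple (round_info R) * R * R => z.1.1).
    by apply: measurableT_comp.
  exact: (cmeasurable_precomp m1 (@cmeasurable_state_of t)).
move=> s; apply: (@cmeasurable_comp _ _ nat _ (fun z : t.-tuple (round_info R) * R * R => cell z.2)).
exact: (cmeasurable_precomp measurable_snd cmeasurable_cell).
Qed.

End Discretization.

(* What [observe] returns for a competing bid in the cell [j]. *)
Definition observed_cell (R : realType) (alpha : R) (k j : nat) : nat :=
  if alpha == 0 then (if (j <= k)%N then 0%N else k.+1) else minn j k.+1.

(* Reward of the bid [grid K k] at the value [grid K i] when the distribution
   function [g] of the competing bids is only known on the grid. *)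
Definition grid_rew (R : realType) (K : nat) (alpha : R) (g : nat -> R) (i k : nat) : R :=
  (grid R K i - grid R K k) * g k + alpha / K%:R * \sum_(l < k) g l.

(** * Distributions seen on the grid *)

Section CellDistribution.
Context (R : realType) (K : nat) (K0 : (0 < K)%N).
Local Notation grid := (grid R K).
Local Notation cell := (@cell R K).

Definition cell_mass (P : probability R R) i : R := fine (P [set x | cell x = i]).

Let mcell i : measurable [set x : R | cell x = i].
Proof. exact: cmeasurable_cell. Qed.

Let cell_sum (phi : nat -> R) x :
  phi (cell x) = \sum_(i < K.+2) phi i * \1_([set x | cell x = i]) x.
Proof.
rewrite (bigD1 (Ordinal (cell_le_size K x : (cell x < K.+2)%N)))//= indicE mem_set// mulr1.
rewrite big1 ?addr0// => i ix; rewrite indicE memNset ?mulr0//= => xi.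
by move: ix; rewrite -val_eqE/= xi eqxx.
Qed.

Let integrable_cell_indic (P : probability R R) (r : R) i :
  P.-integrable setT (fun x => (r * \1_([set x | cell x = i]) x)%:E).
Proof.
under eq_fun do rewrite EFinM.
by apply: integrableZl => //; exact: integrable_indic.
Qed.

Lemma integrable_cell (P : probability R R) (phi : nat -> R) :
  P.-integrable setT (fun x => (phi (cell x))%:E).
Proof.
under eq_fun do rewrite cell_sum -sumEFin.
by apply: integrable_sum => // i _; exact: integrable_cell_indic.
Qed.

Lemma integral_cell (P : probability R R) (phi : nat -> R) :
  (\int[P]_x (phi (cell x))%:E = (\sum_(i < K.+2) cell_mass P i * phi i)%:E)%E.
Proof.
under eq_integral do rewrite cell_sum -sumEFin.
rewrite integral_sum//; last by move=> i; exact: integrable_cell_indic.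
rewrite -sumEFin; apply: eq_bigr => i _.
under eq_integral do rewrite EFinM.
have iW : P.-integrable setT (fun x => (\1_([set x | cell x = i]) x)%:E).
  by have := integrable_cell_indic P 1 i; under eq_fun do rewrite mul1r.
rewrite integralZl// integral_indic// setIT.
have PW : P [set x | cell x = i] = (cell_mass P i)%:E by rewrite fineK// fin_num_measure.
transitivity ((phi i)%:E * (cell_mass P i)%:E)%E; first by congr (_ * _)%E.
by rewrite -EFinM mulrC.
Qed.

Lemma cell_mass_ge0 P i : 0 <= cell_mass P i.
Proof. by rewrite fine_ge0. Qed.

Lemma sum_cell_mass P : \sum_(i < K.+2) cell_mass P i = 1.
Proof.
apply: EFin_inj; rewrite -(integral_prob_cst P 1) (integral_cell P (fun=> 1)).
by under [in RHS]eq_bigr do rewrite mulr1.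
Qed.

Lemma cdf_grid (G : probability R R) l : (l <= K)%N ->
  Defs.cdf G (grid l) = \sum_(j < K.+2) cell_mass G j * (j <= l)%N%:R.
Proof.
move=> lK; apply: EFin_inj; rewrite -(integral_cell G (fun j => (j <= l)%N%:R)) cdfE.
transitivity (\int[G]_x (\1_([set y | y <= grid l]) x)%:E)%E.
  rewrite integral_indic ?setIT//.
  by rewrite -set_itvNyc; exact: measurable_itv.
apply: eq_integral => x _; rewrite indicE cell_le//; congr (_%:R%:E).
by case: (boolP (x <= _)) => h; [rewrite mem_set|rewrite memNset//=; exact/negP].
Qed.

Lemma cell_mass_value_dist (F : probability R R) : value_dist F -> cell_mass F K.+1 = 0.
Proof.
move=> hF; rewrite /cell_mass.
suff -> : F [set x | cell x = K.+1] = 0%E by [].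
apply/eqP; rewrite -measure_le0 -(value_dist_setC hF); apply: le_measure; rewrite ?inE//.
  by apply: measurableC.
move=> x /= xK; rewrite in_itv/= => x01.
by have [+ _ _] := cell_bounds K0 x01; rewrite xK ltnn.
Qed.

End CellDistribution.

(** * Regret bounded by a potential on states *)

Section Master.
Context (R : realType) (K : nat) (K0 : (0 < K)%N) (alpha : R) (F G : probability R R).
Context (pol : state -> nat -> nat) (rstar : nat -> R) (T : nat) (Psi : nat -> state -> R).
Hypotheses (a01 : 0 <= alpha <= 1) (hF : value_dist F).
Local Notation grid := (grid R K).
Local Notation cell := (@cell R K).
Local Notation g := (fun l => Defs.cdf G (grid l)).
Local Notation rho := (grid_rew K alpha g).
Local Notation p := (cell_mass K F).
Local Notation q := (cell_mass K G).
Local Notation observed_cell := (observed_cell alpha).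

Hypothesis polK : forall s i, (pol s i <= K)%N.
Hypothesis rstar_ub : forall i k, (i <= K)%N -> (k <= K)%N -> rho i k <= rstar i.

Let K0' : 0 < K%:R :> R. Proof. by rewrite ltr0n. Qed.

Lemma observeE k d : (k <= K)%N ->
  let x : R := if d <= grid k then 1 else 0 in
  observe K alpha k x (x * (alpha * d + (1 - alpha) * grid k)) = observed_cell k (cell d).
Proof.
move=> kK /=; rewrite /observe /observed_cell cell_le//.
case: (boolP (d <= grid k)) => dk; last first.
  rewrite eqxx; case: ifP => // _; apply/esym/minn_idPr.
  by rewrite ltnNge cell_le.
rewrite oner_eq0 mul1r addrK; case: eqP => [->|/eqP a0].
  rewrite mul0r mul0r; have -> : cell 0 = 0%N; last by rewrite min0n.
  by apply/eqP; rewrite -leqn0 cell_le// grid_ge0.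
by rewrite mulrAC divff// mul1r.
Qed.

(** The sum in [grid_rew] is a left Riemann sum of a nondecreasing function, and its errors
    telescope to at most [g k / K]. *)
Lemma grid_rew_close i k : (k <= K)%N ->
  rho i k <= rew G (grid i) (grid k) alpha <= rho i k + K%:R^-1.
Proof.
move=> kK; rewrite rewE /grid_rew.
suff : \sum_(l < k) g l / K%:R <= cdf_int G (grid k) <= \sum_(l < k) g l / K%:R + g k / K%:R.
  rewrite -!mulr_suml; set S := \sum_(l < k) _.
  move=> /andP[h1 h2]; have /andP[al0 al1] := a01.
  have g1 : g k / K%:R <= K%:R^-1 by rewrite ler_piMl ?cdf_le1// invr_ge0 ltW.
  have g0 : 0 <= g k / K%:R by rewrite divr_ge0 ?cdf_ge0// ltW.
  rewrite -addrA lerD2l lerD2l mulrAC -mulrA; apply/andP; split; first exact: ler_wpM2l.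
  have : alpha * cdf_int G (grid k) <= alpha * (S / K%:R + g k / K%:R) by exact: ler_wpM2l.
  have : (1 - alpha) * (g k / K%:R) >= 0 by rewrite mulr_ge0// subr_ge0.
  lra.
elim: k kK => [|k IH] kK.
  by rewrite big_ord0 add0r grid0 cdf_int0 lexx/= divr_ge0 ?cdf_ge0.
have /andP[h1 h2] := IH (ltnW kK).
have gS : grid k <= grid k.+1 by rewrite grid_le.
have := cdf_int_bounds G (grid_ge0 R K k) gS.
have -> : grid k.+1 - grid k = K%:R^-1 by rewrite gridS addrC addKr.
rewrite big_ord_recr/= ![K%:R^-1 * _]mulrC => /andP[h3 h4].
apply/andP; split; lra.
Qed.

(** Rounding the value up only helps. Rounding a bid [b <= v] up gains winning probability with the
    factor [v - b >= 0] and raises the price by at most [1 / K]. *)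
Lemma best_rew_grid v : 0 <= v <= 1 -> best_rew G v alpha <= rstar (cell v) + 3 / K%:R.
Proof.
move=> v01; have [cK vc cv] := cell_bounds K0 v01; have /andP[v0 v1] := v01.
apply: best_le_trunc => // b b0 bv.
have b01 : 0 <= b <= 1 by rewrite b0 (le_trans bv).
have [kK bk kb] := cell_bounds K0 b01.
have h1 := rstar_ub cK kK.
have /andP[_ h2] := grid_rew_close (cell v) kK.
have h3 := rew_nondecreasing G (grid (cell b)) alpha vc.
have h4 : rew G v b alpha <= rew G v (grid (cell b)) alpha + K%:R^-1.
  rewrite !rewE; have /andP[al0 al1] := a01.
  have /andP[h5 _] := cdf_int_bounds G b0 bk.
  have h6 : 0 <= cdf_int G (grid (cell b)) - cdf_int G b.
    by apply: le_trans h5; rewrite mulr_ge0 ?subr_ge0 ?cdf_ge0.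
  have h7 : alpha * (cdf_int G (grid (cell b)) - cdf_int G b) >= 0 by rewrite mulr_ge0.
  have h8 : 0 <= (v - b) * (Defs.cdf G (grid (cell b)) - Defs.cdf G b).
    by rewrite mulr_ge0 ?subr_ge0// cdf_nondecreasing.
  have h9 : (grid (cell b) - b) * Defs.cdf G (grid (cell b)) <= K%:R^-1.
    apply: (@le_trans _ _ (grid (cell b) - b)); last by lra.
    by rewrite ler_piMr ?cdf_le1// subr_ge0.
  lra.
have Ki : 0 <= K%:R^-1 :> R by rewrite invr_ge0.
lra.
Qed.

Lemma rew_grid_lower v k : 0 <= v <= 1 -> (k <= K)%N ->
  rho (cell v) k - K%:R^-1 <= rew G v (grid k) alpha.
Proof.
move=> v01 kK; have [cK vc cv] := cell_bounds K0 v01.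
have /andP[h1 _] := grid_rew_close (cell v) kK.
have := rew_lipschitz G (grid (cell v)) v (grid k) alpha.
rewrite (ger0_norm (_ : 0 <= grid (cell v) - v)) ?subr_ge0// ler_norml => /andP[_ h].
lra.
Qed.

Hypothesis Psi0 : forall s, 0 <= Psi 0 s.
Hypothesis PsiS : forall n s, (size s + n.+1 = T)%N ->
  \sum_(i < K.+2) p i * (rstar i - rho i (pol s i) +
     \sum_(j < K.+2) q j * Psi n (rcons s (nat_of_ord i, pol s i, observed_cell (pol s i) j))) <= Psi n.+1 s.

Let beta := mean_best F G alpha.

(** [Psi n] is the regret still to come. The integrand is bounded below by functions that depend on
    the history and the cells only, up to the integrable optimum and reward; their integrals are
    explicit, and [5 / K] per round covers the rounding. *)
Lemma exp_reward_ge n t (h : t.-tuple (round_info R)) : (t + n = T)%N ->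
  ((n%:R * (beta - 5 / K%:R) - Psi n (state_of K alpha pol h))%:E <=
    exp_reward alpha F G (grid_alg K alpha pol) n h)%E.
Proof.
elim: n t h => [|n IH] t h tnT; first by rewrite mul0r sub0r lee_fin oppr_le0.
set s := state_of K alpha pol h.
rewrite -[leLHS]integral_seed_cst; apply: le_integral_nomeas => u _.
set a := n%:R * (beta - 5 / K%:R).
pose phi (i j : nat) := Psi n (rcons s (i, pol s i, observed_cell (pol s i) j)).
pose chi (i : nat) : R := a - 5 / K%:R - (rstar i - rho i (pol s i) + \sum_(j < K.+2) q j * phi i j).
apply: (@le_trans _ _ (\int[F]_v ((best_rew G v alpha)%:E + (chi (cell v))%:E))%E).
  rewrite integralD//; [|exact: integrable_best|exact: integrable_cell].
  rewrite mean_bestE// (integral_cell K0) -EFinD lee_fin -/beta.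
  rewrite /chi; under [X in _ <= _ + X]eq_bigr do rewrite mulrBr.
  rewrite sumrB -mulr_suml (sum_cell_mass K0) mul1r.
  have := @PsiS n s; rewrite size_state_of size_tuple => /(_ tnT) HP.
  by rewrite /a -[n.+1%:R]natr1; move: HP; rewrite /phi; lra.
apply: (ae_le_integral_nomeas _ (value_dist_setC hF)) => // v; rewrite /= in_itv/= => v01.
set i := cell v; set k := pol s i.
have kK : (k <= K)%N by exact: polK.
apply: (@le_trans _ _ (\int[G]_d ((rew G v (grid k) alpha + a)%:E + (- phi i (cell d))%:E))%E).
  rewrite integralD//; [|exact: finite_measure_integrable_cst|exact: (integrable_cell K0 G (fun j => - phi i j))].
  rewrite integral_prob_cst (integral_cell K0 G (fun j => - phi i j)) -EFinD lee_fin.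
  under [X in _ <= _ + X]eq_bigr do rewrite mulrN.
  rewrite sumrN /chi.
  have := best_rew_grid v01; have := rew_grid_lower v01 kK; rewrite -/i -/k.
  have Ki : 0 <= K%:R^-1 :> R by rewrite invr_ge0.
  lra.
apply: le_integral_nomeas => d _.
rewrite EFinD -addeA; apply: leeD; first exact: lexx.
have := @IH t.+1 [tuple of rcons h (u, (v, (if d <= grid k then 1 else 0),
  (if d <= grid k then 1 else 0) * (alpha * d + (1 - alpha) * grid k)))].
rewrite addSnnS => /(_ tnT); rewrite /= state_of_rcons /update /= -/s -/i -/k observeE//.
Qed.

Lemma regret_le_potential :
  (regret alpha F G (grid_alg K alpha pol) T <= (5 * T%:R / K%:R + Psi T [::])%:E)%E.
Proof.
have := @exp_reward_ge T 0 [tuple] (add0n T).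
rewrite /regret mean_bestE// -EFinM -/beta => H.
have -> : 5 * T%:R / K%:R + Psi T [::] = T%:R * beta - (T%:R * (beta - 5 / K%:R) - Psi T [::]) by ring.
by rewrite EFinB; apply: leeB.
Qed.

End Master.

(** * Upper bounds *)

Section Exponential.
Context (R : realType).

(** Invert the square of [expR (- (y / 2)) >= 1 - y / 2]; the remaining polynomial inequality has
    the factor [1 - y]. *)
Lemma expR_le_quad (y : R) : y <= 1 -> expR y <= 1 + y + 2 * y ^+ 2.
Proof.
move=> y1; have h : 0 < 1 - y / 2 by lra.
have e : expR (- (y / 2)) >= 1 - y / 2 by have := expR_ge1Dx (- (y / 2)).
have : expR y <= ((1 - y / 2) ^+ 2)^-1.
  have -> : expR y = (expR (- (y / 2)) ^+ 2)^-1.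
    by rewrite expRN exprVn invrK expr2 -expRD; congr expR; lra.
  by rewrite lef_pV2 ?posrE ?exprn_gt0 ?expR_gt0// ler_pXn2r ?nnegrE ?expR_ge0// ltW.
move=> /le_trans; apply.
rewrite -[leLHS]mul1r ler_pdivrMr ?exprn_gt0//.
have : 0 <= y ^+ 2 * ((1 - y) * (5 / 2 - y)) by rewrite mulr_ge0 ?sqr_ge0// mulr_ge0//; lra.
by lra.
Qed.

Lemma mgf_bernoulli (g y : R) : 0 <= g <= 1 -> `|y| <= 1 ->
  g * expR (y * (1 - g)) + (1 - g) * expR (- (y * g)) <= expR (2 * y ^+ 2).
Proof.
move=> /andP[g0 g1]; rewrite ler_norml => /andP[y1 y2].
have h1 : expR (y * (1 - g)) <= 1 + y * (1 - g) + 2 * (y * (1 - g)) ^+ 2 by apply: expR_le_quad; nra.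
have h2 : expR (- (y * g)) <= 1 - y * g + 2 * (y * g) ^+ 2.
  by have := @expR_le_quad (- (y * g)); rewrite sqrrN; apply; nra.
apply: le_trans (expR_ge1Dx _).
have h3 := ler_wpM2l g0 h1.
have h4 : (1 - g) * expR (- (y * g)) <= (1 - g) * (1 - y * g + 2 * (y * g) ^+ 2).
  by apply: ler_wpM2l => //; rewrite subr_ge0.
have : 0 <= y ^+ 2 * (1 - g * (1 - g)) by rewrite mulr_ge0 ?sqr_ge0//; nra.
lra.
Qed.

End Exponential.

(** * Exponential supermartingales for empirical distribution functions *)

Section Concentration.
Context (R : realType) (K : nat) (alpha L : R) (T : nat) (q g : nat -> R).
Hypotheses (L1 : 1 <= L).
Hypotheses (q_ge0 : forall j, 0 <= q j) (q_sum : \sum_(j < K.+2) q j = 1).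
Hypothesis gE : forall l, (l <= K)%N -> g l = \sum_(j < K.+2) q j * (j <= l)%N%:R.

(* The bid [k] reveals whether the competing bid is at most [grid l]. *)
Definition reveals (k l : nat) : bool := if alpha == 0 then k == l else (l <= k)%N.

Definition reveal_count (l : nat) (s : state) : nat := count (fun e => reveals e.1.2 l) s.

Definition win_count (l : nat) (s : state) : nat :=
  count (fun e => reveals e.1.2 l && (e.2 <= l)%N) s.

Definition deviation (l : nat) (s : state) : R :=
  (win_count l s)%:R - g l * (reveal_count l s)%:R.

Lemma observed_cell_le k j l : reveals k l -> (observed_cell alpha k j <= l)%N = (j <= l)%N.
Proof.
rewrite /reveals /observed_cell; case: ifP => _.
  by move=> /eqP ->; case: (leqP j l) => h; rewrite ?leq0n ?ltnn.
by move=> lk; rewrite geq_min orbC ltnNge lk.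
Qed.

Lemma g_bounds l : (l <= K)%N -> 0 <= g l <= 1.
Proof.
move=> lK; rewrite gE//; apply/andP; split.
  by apply: sumr_ge0 => j _; rewrite mulr_ge0.
by rewrite -[leRHS]q_sum; apply: ler_sum => j _; rewrite ler_piMr// lern1 leq_b1.
Qed.

Definition supermart (y : R) l s : R :=
  expR (y * deviation l s - 2 * y ^+ 2 * (reveal_count l s)%:R - L).

Lemma supermart_step y l s i k : (l <= K)%N -> `|y| <= 1 ->
  \sum_(j < K.+2) q j * supermart y l (rcons s (i, k, observed_cell alpha k j)) <= supermart y l s.
Proof.
move=> lK y1.
have [kl|kl] := boolP (reveals k l); last first.
  rewrite le_eqVlt; apply/orP; left; apply/eqP.
  rewrite -[RHS]mul1r -q_sum mulr_suml; apply: eq_bigr => j _; congr (_ * _).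
  by rewrite /supermart /deviation /win_count /reveal_count -!cats1 !count_cat/= (negbTE kl) /= !addn0.
have -> : \sum_(j < K.+2) q j * supermart y l (rcons s (i, k, observed_cell alpha k j)) =
  supermart y l s * expR (- (2 * y ^+ 2)) *
    (g l * expR (y * (1 - g l)) + (1 - g l) * expR (- (y * g l))).
  have -> : g l * expR (y * (1 - g l)) + (1 - g l) * expR (- (y * g l)) =
    \sum_(j < K.+2) q j * (if (j <= l)%N then expR (y * (1 - g l)) else expR (- (y * g l))).
    have -> : 1 - g l = \sum_(j < K.+2) q j * (1 - (j <= l)%N%:R).
      by under [RHS]eq_bigr do rewrite mulrBr mulr1; rewrite sumrB q_sum -gE.
    rewrite [X in X * _ + _]gE// !mulr_suml -big_split; apply: eq_bigr => j _ /=.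
    by case: ifP => _ /=; ring.
  rewrite mulr_sumr; apply: eq_bigr => j _; rewrite mulrCA; congr (_ * _).
  rewrite /supermart -expRD.
  rewrite (_ : deviation l (rcons s _) = deviation l s + ((j <= l)%N%:R - g l)).
    rewrite (_ : reveal_count l (rcons s _) = (reveal_count l s).+1).
      by case: ifP => _ /=; rewrite -expRD; congr expR; rewrite -natr1; ring.
    by rewrite /reveal_count -cats1 count_cat/= kl addn1.
  rewrite /deviation /win_count /reveal_count -cats1 !count_cat/= kl/= observed_cell_le// !addn0.
  by rewrite !natrD; ring.
have h := mgf_bernoulli (g_bounds lK) y1.
rewrite -mulrA ler_piMr ?expR_ge0//.
rewrite expRN mulrC ler_pdivrMr ?expR_gt0// mul1r.
exact: h.
Qed.

(* The optimal exponent for a deviation after [m] observations. Summing the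
   supermartingales over all [m] replaces a union bound over the random number
   of observations. *)
Definition tilt (m : nat) : R := if L <= m%:R then Num.sqrt (L / m%:R) else 0.

Definition supermart_sum (s : state) : R :=
  \sum_(m < T) \sum_(l < K.+1) (supermart (tilt m.+1) l s + supermart (- tilt m.+1) l s).

Lemma tilt_bounds m : `|tilt m| <= 1.
Proof.
rewrite /tilt; case: ifP => [Lm|_]; last by rewrite normr0.
have m0 : 0 < m%:R :> R by apply: lt_le_trans Lm; have := L1; lra.
by rewrite ger0_norm ?sqrtr_ge0// -[leRHS]sqrtr1 ler_sqrt// ler_pdivrMr// mul1r.
Qed.

Lemma supermart_sum_ge0 s : 0 <= supermart_sum s.
Proof. by apply: sumr_ge0 => m _; apply: sumr_ge0 => l _; rewrite addr_ge0 ?expR_ge0. Qed.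

Lemma supermart_sum_step s i k :
  \sum_(j < K.+2) q j * supermart_sum (rcons s (i, k, observed_cell alpha k j)) <= supermart_sum s.
Proof.
rewrite /supermart_sum; under eq_bigr do rewrite mulr_sumr.
rewrite exchange_big/=; apply: ler_sum => m _.
under eq_bigr do rewrite mulr_sumr.
rewrite exchange_big/=; apply: ler_sum => l _.
under eq_bigr do rewrite mulrDr.
have lK : (l <= K)%N by rewrite -ltnS.
rewrite big_split/=; apply: lerD; apply: supermart_step => //; rewrite ?normrN; exact: tilt_bounds.
Qed.

Lemma supermart_sum_nil : supermart_sum [::] = 2 * T%:R * K.+1%:R * expR (- L).
Proof.
rewrite /supermart_sum /supermart /deviation /win_count /reveal_count /=.
under eq_bigr do under eq_bigr do rewrite !(mulr0, subr0, sub0r, oppr0, add0r).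
by rewrite !sumr_const !card_ord -[LHS]mulr_natr -[X in X * _]mulr_natr; ring.
Qed.

Definition concentrated (s : state) : bool :=
  [forall l : 'I_K.+1, `|deviation l s| <= 3 * Num.sqrt (L * (reveal_count l s)%:R)].

(** At [y = sqrt (L / m)] a deviation beyond [3 * sqrt (L * m)] makes the exponent at least
    [3 L - 2 L - L = 0], so one summand reaches 1. For [m < L] the trivial bound [m] on the
    deviation rules failure out. *)
Lemma not_concentrated_le s : (size s <= T)%N -> (~~ concentrated s)%:R <= supermart_sum s.
Proof.
move=> sT; have [cs|ncs] := boolP (concentrated s); first exact: supermart_sum_ge0.
rewrite /=; move: ncs; rewrite negb_forall => /existsP[l]; rewrite -ltNge.
set m := reveal_count l s => dl.
have lK : (l <= K)%N by rewrite -ltnS.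
have wm : (win_count l s <= m)%N by apply: sub_count => e /= /andP[].
have mT : (m <= T)%N by rewrite (leq_trans (count_size _ _) sT).
have /andP[g0 g1] := g_bounds lK.
have dm : `|deviation l s| <= m%:R.
  rewrite ler_norml /deviation -/m.
  have : (win_count l s)%:R <= m%:R :> R by rewrite ler_nat.
  have : 0 <= (win_count l s)%:R :> R by [].
  have : 0 <= (1 - g l) * m%:R by rewrite mulr_ge0// subr_ge0.
  have : 0 <= g l * m%:R by rewrite mulr_ge0.
  by move=> h1 h2 h3 h4; apply/andP; split; lra.
have L0 : 0 < L by apply: lt_le_trans L1.
have sq0 : 0 <= Num.sqrt (L * m%:R) by exact: sqrtr_ge0.
have sqE : Num.sqrt (L * m%:R) ^+ 2 = L * m%:R by rewrite sqr_sqrtr// mulr_ge0// ltW.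
have Lm : L <= m%:R.
  rewrite leNgt; apply/negP => mL.
  have : Num.sqrt (L * m%:R) ^+ 2 >= m%:R ^+ 2 by rewrite sqE expr2 ler_wpM2r// ltW.
  rewrite ler_pXn2r ?nnegrE// => h; lra.
have m0 : (0 < m)%N by rewrite -(ltr0n R); exact: lt_le_trans Lm.
have m0' : 0 < m%:R :> R by rewrite ltr0n.
pose y := Num.sqrt (L / m%:R).
have yE : tilt m = y by rewrite /tilt Lm.
have y0 : 0 <= y by exact: sqrtr_ge0.
have y2 : y ^+ 2 * m%:R = L by rewrite sqr_sqrtr ?divfK ?gt_eqF// divr_ge0// ltW.
have ysq : y * Num.sqrt (L * m%:R) = L.
  rewrite -sqrtrM; last by rewrite divr_ge0// ltW.
  by rewrite mulrACA mulVf ?gt_eqF// mulr1 -expr2 sqrtr_sqr ger0_norm// ltW.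
have key z : 0 <= z -> 3 * Num.sqrt (L * m%:R) < z -> 0 <= y * z - 2 * y ^+ 2 * m%:R - L.
  move=> z0 hz; have : y * (3 * Num.sqrt (L * m%:R)) <= y * z by rewrite ler_wpM2l// ltW.
  rewrite -[2 * _ * _]mulrA y2 mulrCA ysq; lra.
have one : 1 <= supermart (tilt m) l s + supermart (- tilt m) l s.
  rewrite yE; have [d0|d0] := leP 0 (deviation l s).
    rewrite ler_wpDr ?expR_ge0// /supermart -/m -[leLHS]expR0 ler_expR.
    by apply: key => //; rewrite -(ger0_norm d0).
  rewrite ler_wpDl ?expR_ge0// /supermart -/m -[leLHS]expR0 ler_expR mulNr -mulrN sqrrN.
  by apply: key; [rewrite oppr_ge0 ltW|rewrite -(ltr0_norm d0)].
have mT' : (m.-1 < T)%N by rewrite prednK.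
rewrite /supermart_sum (bigD1 (Ordinal mT'))//= prednK//.
rewrite (bigD1 l)//= -addrA -addrA addrA ler_wpDr//.
rewrite addr_ge0//; first by apply: sumr_ge0 => *; rewrite addr_ge0 ?expR_ge0.
by apply: sumr_ge0 => *; apply: sumr_ge0 => *; rewrite addr_ge0 ?expR_ge0.
Qed.

End Concentration.

(** * Confidence widths for rewards *)

Section Estimation.
Context (R : realType) (K : nat) (alpha L : R) (g : nat -> R).
Hypotheses (K0 : (0 < K)%N) (a01 : 0 <= alpha <= 1) (L1 : 1 <= L).
Hypothesis g01 : forall l, (l <= K)%N -> 0 <= g l <= 1.
Local Notation grid := (grid R K).
Local Notation count_of := (reveal_count alpha).

Definition ghat (s : state) (l : nat) : R := (win_count alpha l s)%:R / (count_of l s)%:R.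

(** [n.+1] keeps the width finite without observations; 6 rather than 3 pays for
    [sqrt (n + 1) <= 2 * sqrt n]. *)
Definition width (n : nat) : R := 6 * Num.sqrt L / Num.sqrt n.+1%:R.

Definition est_rew (s : state) := grid_rew K alpha (ghat s).

Lemma width_gt0 n : 0 < width n.
Proof.
rewrite /width divr_gt0 ?sqrtr_gt0 ?ltr0n// mulr_gt0// sqrtr_gt0.
by apply: lt_le_trans L1.
Qed.

Lemma width_nonincreasing m n : (m <= n)%N -> width n <= width m.
Proof.
move=> mn; rewrite /width ler_wpM2l ?mulr_ge0 ?sqrtr_ge0//.
by rewrite lef_pV2 ?posrE ?sqrtr_gt0 ?ltr0n// ler_sqrt// ler_nat.
Qed.

Lemma ghat_close s l : concentrated K alpha L g s -> (l <= K)%N ->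
  `|ghat s l - g l| <= width (count_of l s).
Proof.
move=> /forallP cs lK; have := cs (Ordinal (lK : (l < K.+1)%N)) => /=.
rewrite /deviation /ghat; set n := count_of l s; set w := win_count alpha l s => dl.
have L0 : 0 < L by apply: lt_le_trans L1.
have /andP[g0 g1] := g01 lK.
have sL : 1 <= Num.sqrt L by rewrite -[leLHS]sqrtr1 ler_sqrt// ltW.
have [n0|n0] := posnP n.
  rewrite n0 invr0 mulr0 sub0r normrN ger0_norm// /width sqrtr1 divr1.
  by have := L1; lra.
have n0' : 0 < n%:R :> R by rewrite ltr0n.
have sn : 0 < Num.sqrt n%:R :> R by rewrite sqrtr_gt0.
have snE : Num.sqrt n%:R ^+ 2 = n%:R :> R by rewrite sqr_sqrtr// ltW.
have -> : w%:R / n%:R - g l = (w%:R - g l * n%:R) / n%:R by field; rewrite gt_eqF.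
rewrite normrM normfV (gtr0_norm n0') ler_pdivrMr//; apply: le_trans dl _.
rewrite sqrtrM; last exact: ltW.
have s2 : Num.sqrt n.+1%:R <= 2 * Num.sqrt n%:R :> R.
  rewrite -(@ler_pXn2r _ 2) ?nnegrE ?mulr_ge0 ?sqrtr_ge0//.
  rewrite exprMn snE sqr_sqrtr// -natr1.
  have : 1 <= n%:R :> R by rewrite ler1n.
  lra.
have sn1 : 0 < Num.sqrt n.+1%:R :> R by rewrite sqrtr_gt0 ltr0n.
rewrite /width mulrAC ler_pdivlMr//.
rewrite -[X in _ <= _ * X]snE.
have := ler_wpM2l (_ : 0 <= 3 * Num.sqrt L * Num.sqrt n%:R) s2.
rewrite !mulr_ge0 ?sqrtr_ge0// => /(_ isT).
by rewrite expr2; lra.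
Qed.

Lemma reveal_count_le k l s : (l <= k)%N -> alpha != 0 -> (count_of k s <= count_of l s)%N.
Proof.
move=> lk a0; apply: sub_count => e /=; rewrite /reveals (negbTE a0).
exact: leq_trans.
Qed.

(** Level [k] is the least observed one involved: for [alpha > 0] lower levels are observed at least
    as often, and for [alpha = 0] their sum vanishes. *)
Lemma est_close s i k : concentrated K alpha L g s -> (i <= K)%N -> (k <= K)%N ->
  `|est_rew s i k - grid_rew K alpha g i k| <= 2 * width (count_of k s).
Proof.
move=> cs iK kK; rewrite /est_rew /grid_rew.
set w := width _.
have -> : (grid i - grid k) * ghat s k + alpha / K%:R * \sum_(l < k) ghat s l -
   ((grid i - grid k) * g k + alpha / K%:R * \sum_(l < k) g l) =
   (grid i - grid k) * (ghat s k - g k) + alpha / K%:R * \sum_(l < k) (ghat s l - g l).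
  by rewrite sumrB; ring.
apply: le_trans (ler_normD _ _) _.
have K0' : 0 < K%:R :> R by rewrite ltr0n.
have w0 : 0 < w by exact: width_gt0.
have h1 : `|(grid i - grid k) * (ghat s k - g k)| <= w.
  rewrite normrM; apply: le_trans (_ : _ <= 1 * w) _; last by rewrite mul1r.
  apply: ler_pM => //; last exact: ghat_close.
  have := grid_ge0 R K i; have := grid_ge0 R K k.
  have := grid_le1 R K0 iK; have := grid_le1 R K0 kK => ? ? ? ?.
  by rewrite ler_norml; apply/andP; split; lra.
have h2 : `|alpha / K%:R * \sum_(l < k) (ghat s l - g l)| <= w.
  have [a0|a0] := eqVneq alpha 0; first by rewrite a0 !mul0r normr0 ltW.
  have /andP[al0 al1] := a01.
  have hs : `|\sum_(l < k) (ghat s l - g l)| <= k%:R * w.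
    apply: le_trans (ler_norm_sum _ _ _) _.
    apply: (@le_trans _ _ (\sum_(l < k) w)); last by rewrite sumr_const card_ord mulr_natl.
    apply: ler_sum => l _; apply: le_trans (ghat_close cs _) _.
      by rewrite (leq_trans _ kK)// ltnW.
    by apply: width_nonincreasing; apply: reveal_count_le => //; exact: ltnW.
  rewrite normrM ger0_norm ?divr_ge0//.
  apply: (@le_trans _ _ (1 / K%:R * (K%:R * w))); last by rewrite mul1r mulKf// gt_eqF.
  apply: ler_pM => //; first by rewrite divr_ge0.
    by rewrite ler_wpM2r// invr_ge0.
  by apply: le_trans hs _; rewrite ler_wpM2r ?ler_nat// ltW.
lra.
Qed.

End Estimation.

(** * Combining failure, concentration and budget *)

Section Potential.
Context (R : realType) (K : nat) (alpha L : R) (T : nat) (p q g : nat -> R).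
Hypotheses (K0 : (0 < K)%N) (a01 : 0 <= alpha <= 1) (L1 : 1 <= L).
Hypotheses (p_ge0 : forall j, 0 <= p j) (p_sum : \sum_(j < K.+2) p j = 1) (pK : p K.+1 = 0).
Hypotheses (q_ge0 : forall j, 0 <= q j) (q_sum : \sum_(j < K.+2) q j = 1).
Hypothesis gE : forall l, (l <= K)%N -> g l = \sum_(j < K.+2) q j * (j <= l)%N%:R.
Context (pol : state -> nat -> nat) (rstar : nat -> R) (good : state -> bool).
Context (Theta : nat -> state -> R) (c : R).
Local Notation rho := (grid_rew K alpha g).
Local Notation conc := (concentrated K alpha L g).
Hypothesis c0 : 0 <= c.
Hypothesis gap_le3 : forall s i, (i <= K)%N -> rstar i - rho i (pol s i) <= 3.
Hypothesis gap_good : forall s i, (i <= K)%N -> good s -> conc s ->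
  rstar i - rho i (pol s i) <= c / Num.sqrt (reveal_count alpha (pol s i) s).+1%:R.
Hypothesis good_step : forall s i o, (i <= K)%N -> good s -> conc s ->
  good (rcons s (i, pol s i, o)).
Hypothesis Theta0 : forall s, 0 <= Theta 0 s.
Hypothesis ThetaS : forall n s, (size s + n.+1 = T)%N ->
  \sum_(i < K.+2) p i * ((Num.sqrt (reveal_count alpha (pol s i) s).+1%:R)^-1 +
    \sum_(j < K.+2) q j * Theta n (rcons s (nat_of_ord i, pol s i, observed_cell alpha (pol s i) j)))
  <= Theta n.+1 s.

(* [good] may fail only after a failure of concentration; from then on every
   remaining round is charged the maximal gap 3. *)
Definition potential n s : R :=
  3 * n%:R * (~~ good s)%:R + 3 * n%:R ^+ 2 * supermart_sum K alpha L T g s + c * Theta n s.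

Lemma potential_ge0 s : 0 <= potential 0 s.
Proof. by rewrite /potential expr0n /= !mulr0 !mul0r !add0r mulr_ge0. Qed.

(** A failure of concentration may spoil all [n.+1] remaining rounds. Its indicator is at most the
    supermartingale, and [n ^ 2 + n + 1 <= (n + 1) ^ 2] absorbs it. *)
Lemma potential_step n s : (size s + n.+1 = T)%N ->
  \sum_(i < K.+2) p i * (rstar i - rho i (pol s i) +
     \sum_(j < K.+2) q j *
       potential n (rcons s (nat_of_ord i, pol s i, observed_cell alpha (pol s i) j))) <=
  potential n.+1 s.
Proof.
move=> snT.
pose ng : R := (~~ good s)%:R; pose nc : R := (~~ conc s)%:R.
pose M := supermart_sum K alpha L T g s.
have M0 : 0 <= M by exact: supermart_sum_ge0.
have ng0 : 0 <= ng by [].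
have nc0 : 0 <= nc by [].
have ncM : nc <= M.
  apply: (not_concentrated_le alpha L1 q_ge0 q_sum gE).
  by rewrite -snT leq_addr.
pose th (i : nat) := (Num.sqrt (reveal_count alpha (pol s i) s).+1%:R)^-1 +
    \sum_(j < K.+2) q j * Theta n (rcons s (i, pol s i, observed_cell alpha (pol s i) j)).
apply: (@le_trans _ _ (\sum_(i < K.+2) p i * (3 * n.+1%:R * (ng + nc) + 3 * n%:R ^+ 2 * M + c * th i))).
  apply: ler_sum => i _.
  have [iK|iK] := leqP i K; last first.
    have -> : nat_of_ord i = K.+1 by apply/eqP; rewrite eqn_leq iK -ltnS ltn_ord.
    by rewrite pK !mul0r.
  apply: ler_wpM2l => //.
  have hgap : rstar i - rho i (pol s i) <= 3 * (ng + nc) + c / Num.sqrt (reveal_count alpha (pol s i) s).+1%:R.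
    have hc : 0 <= c / Num.sqrt (reveal_count alpha (pol s i) s).+1%:R by rewrite divr_ge0// sqrtr_ge0.
    have := gap_le3 s iK; have := @gap_good s i iK.
    rewrite /ng /nc; case: (good s) => /=; case: (conc s) => /= h1 h2.
    - by have := h1 isT isT; lra.
    - lra.
    - lra.
    - lra.
  have hpot : \sum_(j < K.+2) q j *
       potential n (rcons s (nat_of_ord i, pol s i, observed_cell alpha (pol s i) j)) <=
     3 * n%:R * (ng + nc) + 3 * n%:R ^+ 2 * M + c * \sum_(j < K.+2) q j *
       Theta n (rcons s (nat_of_ord i, pol s i, observed_cell alpha (pol s i) j)).
    under eq_bigr do rewrite /potential mulrDr mulrDr.
    rewrite !big_split/=; apply: lerD; first apply: lerD.
    - apply: (@le_trans _ _ (\sum_(j < K.+2) q j * (3 * n%:R * (ng + nc)))); last first.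
        by rewrite -mulr_suml q_sum mul1r.
      apply: ler_sum => j _; apply: ler_wpM2l => //; apply: ler_wpM2l; first by rewrite mulr_ge0.
      have := @good_step s i (observed_cell alpha (pol s i) j) iK.
      rewrite /ng /nc; case: (good s) => /=; case: (conc s) => /= h.
      + by rewrite h //= addr0.
      + by rewrite add0r lern1 leq_b1.
      + by rewrite addr0 lern1 leq_b1.
      + by apply: (@le_trans _ _ 1); [rewrite lern1 leq_b1|lra].
    - under eq_bigr do rewrite mulrCA.
      rewrite -mulr_sumr ler_wpM2l ?mulr_ge0 ?exprn_ge0//.
      exact: (supermart_sum_step alpha T L1 q_ge0 q_sum gE).
    - by under eq_bigr do rewrite mulrCA; rewrite -mulr_sumr.
  rewrite /th mulrDr -natr1.
  lra.
under eq_bigr do rewrite mulrDr.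
rewrite big_split/= -mulr_suml p_sum mul1r.
under [X in _ + X <= _]eq_bigr do rewrite mulrCA.
rewrite -mulr_sumr /potential -/ng -/M.
apply: lerD; last by apply: ler_wpM2l => //; exact: ThetaS.
have : n.+1%:R * nc <= n.+1%:R * M by rewrite ler_wpM2l.
have : 0 <= n%:R * M by rewrite mulr_ge0.
rewrite -[n.+1%:R]natr1; nra.
Qed.

End Potential.

Section SquareRoots.
Context (R : realType).

Lemma sqrt_increment (x y : R) : 0 <= x -> x <= y -> (y - x) / Num.sqrt y <= 2 * (Num.sqrt y - Num.sqrt x).
Proof.
move=> x0 xy; have y0 : 0 <= y by exact: le_trans xy.
have [yE|yn0] := eqVneq y 0.
  have -> : x = 0 by apply/eqP; rewrite eq_le x0 andbT -yE.
  by rewrite yE subrr mul0r subrr mulr0.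
have yp : 0 < y by rewrite lt_def yn0.
have sy : 0 < Num.sqrt y by rewrite sqrtr_gt0.
rewrite ler_pdivrMr//.
have hx : Num.sqrt x ^+ 2 = x by rewrite sqr_sqrtr.
have hy : Num.sqrt y ^+ 2 = y by rewrite sqr_sqrtr.
rewrite -{1}hx -{1}hy.
have := sqr_ge0 (Num.sqrt y - Num.sqrt x); nra.
Qed.

Lemma sqrt_incrementS (n : nat) :
  (Num.sqrt n.+1%:R)^-1 <= 2 * (Num.sqrt n.+1%:R - Num.sqrt n%:R) :> R.
Proof.
have nn : n%:R <= n.+1%:R :> R by rewrite ler_nat.
have := sqrt_increment (ler0n R n) nn.
by rewrite (_ : n.+1%:R - n%:R = 1 :> R) ?div1r// -natrB// subSnn.
Qed.

Lemma sqrt_amgm (x t : R) : 0 <= x -> 0 < t -> 0 <= x / t + t - 2 * Num.sqrt x.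
Proof.
move=> x0 t0; have hx : Num.sqrt x ^+ 2 = x by rewrite sqr_sqrtr.
have -> : x / t + t - 2 * Num.sqrt x = (Num.sqrt x - t) ^+ 2 / t.
  by rewrite -{1}hx; field; rewrite gt_eqF.
by rewrite divr_ge0 ?sqr_ge0// ltW.
Qed.

End SquareRoots.

(** * Monotone optimal bids *)

Section Maximizer.
Context (R : realType) (K : nat) (alpha : R) (g : nat -> R).
Hypotheses (K0 : (0 < K)%N) (a01 : 0 <= alpha <= 1).
Hypothesis g01 : forall l, (l <= K)%N -> 0 <= g l <= 1.
Hypothesis g_mono : forall k l, (k <= l <= K)%N -> g k <= g l.
Local Notation rho := (grid_rew K alpha g).

Let is_max i (k : 'I_K.+1) := [forall k' : 'I_K.+1, rho i k' <= rho i k].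

(* The largest maximizer, which is what makes [best_idx] monotone. *)
Definition best_idx (i : nat) : nat :=
  [arg max_(k > [arg max_(k > ord0 : 'I_K.+1) rho i k]%O | is_max i k) (k : nat)].

Let best_idxP i : [/\ (best_idx i <= K)%N, forall k, (k <= K)%N -> rho i k <= rho i (best_idx i) &
  forall k, (k <= K)%N -> (forall k', (k' <= K)%N -> rho i k' <= rho i k) -> (k <= best_idx i)%N].
Proof.
rewrite /best_idx; case: arg_maxnP => [|k km kmax].
  case: Order.TotalTheory.arg_maxP => //= k _ km; apply/forallP => k'; exact: km.
split; first by rewrite -ltnS.
- move=> k' k'K; move/forallP : km => /(_ (Ordinal (k'K : (k' < K.+1)%N))); exact.
- move=> k' k'K k'm; apply: (kmax (Ordinal (k'K : (k' < K.+1)%N))).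
  by apply/forallP => k''; apply: k'm; rewrite -ltnS.
Qed.

Lemma best_idx_le i : (best_idx i <= K)%N.
Proof. by have [] := best_idxP i. Qed.

Lemma best_idx_max i k : (k <= K)%N -> rho i k <= rho i (best_idx i).
Proof. by have [_ h _] := best_idxP i; exact: h. Qed.

(** Increasing differences: a larger value adds [(grid i' - grid i) * (g k - g k') >= 0] to the
    advantage of a larger bid [k] over [k']. A maximizer at [i] above [best_idx i'] would thus
    maximize at [i'] too. *)
Lemma best_idx_mono i i' : (i <= i')%N -> (best_idx i <= best_idx i')%N.
Proof.
move=> ii'; rewrite leqNgt; apply/negP => lt.
have [kK km _] := best_idxP i; have [k'K k'm k'l] := best_idxP i'.
suff : (best_idx i <= best_idx i')%N by rewrite leqNgt lt.
apply: k'l => // k'' k''K.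
apply: le_trans (k'm _ k''K) _.
have := km _ k'K; rewrite /grid_rew.
set k := best_idx i; set k' := best_idx i'.
have gg : g k' <= g k by apply: g_mono; rewrite kK ltnW.
have gii : grid R K i <= grid R K i' by rewrite grid_le.
have : 0 <= (grid R K i' - grid R K i) * (g k - g k') by rewrite mulr_ge0// subr_ge0.
lra.
Qed.

Lemma grid_rew_bounds i k : (i <= K)%N -> (k <= K)%N -> -1 <= rho i k <= 2.
Proof.
move=> iK kK; rewrite /grid_rew.
have /andP[al0 al1] := a01.
have K0' : 0 < K%:R :> R by rewrite ltr0n.
have := grid_ge0 R K i; have := grid_ge0 R K k.
have := grid_le1 R K0 iK; have := grid_le1 R K0 kK => i1 k1 k0 i0.
have /andP[g0 g1] := g01 kK.
have S0 : 0 <= \sum_(l < k) g l.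
  apply: sumr_ge0 => l _; have /andP[] // := g01 (leq_trans (ltnW (ltn_ord l)) kK).
have S1 : \sum_(l < k) g l <= K%:R.
  apply: (@le_trans _ _ (\sum_(l < k) 1)); last by rewrite sumr_const card_ord ler_nat.
  by apply: ler_sum => l _; have /andP[] // := g01 (leq_trans (ltnW (ltn_ord l)) kK).
have : 0 <= alpha / K%:R * \sum_(l < k) g l by rewrite mulr_ge0// divr_ge0.
have : alpha / K%:R * \sum_(l < k) g l <= 1.
  by rewrite mulrAC ler_pdivrMr// mul1r; apply: le_trans S1; rewrite ler_piMl.
move: (alpha / _ * _) => z z1 z0.
by apply/andP; split; nra.
Qed.

End Maximizer.

(** * Upper-confidence rule for [alpha = 0] *)

Section UCB.
Context (R : realType) (K : nat) (L theta : R) (T : nat) (p q g : nat -> R).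
Hypotheses (K0 : (0 < K)%N) (L1 : 1 <= L) (t0 : 0 < theta).
Hypotheses (p_ge0 : forall j, 0 <= p j) (p_sum : \sum_(j < K.+2) p j = 1).
Hypotheses (q_sum : \sum_(j < K.+2) q j = 1).
Hypothesis g01 : forall l, (l <= K)%N -> 0 <= g l <= 1.
Local Notation count_of := (reveal_count (0 : R)).
Local Notation rho := (grid_rew K 0 g).

Definition ucb (s : state) (i : nat) : nat :=
  [arg max_(k > ord0 : 'I_K.+1) (est_rew K 0 s i k + 2 * width L (count_of k s))]%O.

Lemma ucb_le s i : (ucb s i <= K)%N.
Proof. by rewrite -ltnS /ucb ltn_ord. Qed.

Lemma ucb_gap s i : (i <= K)%N -> concentrated K 0 L g s ->
  rho i (best_idx K 0 g i) - rho i (ucb s i) <= 24 * Num.sqrt L / Num.sqrt (count_of (ucb s i) s).+1%:R.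
Proof.
move=> iK cs; have a01 : 0 <= (0 : R) <= 1 by rewrite lexx ler01.
set b := best_idx K 0 g i; have bK : (b <= K)%N by exact: best_idx_le.
have := est_close K0 a01 L1 g01 cs iK bK; have := est_close K0 a01 L1 g01 cs iK (ucb_le s i).
have : est_rew K 0 s i b + 2 * width L (count_of b s) <=
       est_rew K 0 s i (ucb s i) + 2 * width L (count_of (ucb s i) s).
  rewrite /ucb; case: Order.TotalTheory.arg_maxP => //= k _ km.
  exact: (km (Ordinal (bK : (b < K.+1)%N))).
rewrite !ler_norml => h1 /andP[h2 h3] /andP[h4 h5].
have -> : 24 * Num.sqrt L / Num.sqrt (count_of (ucb s i) s).+1%:R = 4 * width L (count_of (ucb s i) s).
  by rewrite /width; ring.
lra.
Qed.

(** By AM-GM [2 * sqrt N <= N / theta + theta] for each bid, and the counts sum to at most the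
    number of rounds, so the budget ends nonnegative. A round lowers it by
    [2 * (sqrt (N + 1) - sqrt N)], which pays for [1 / sqrt (N + 1)]. *)
Definition ucb_budget (n : nat) (s : state) : R :=
  (size s + n)%:R / theta + K.+1%:R * theta - 2 * \sum_(l < K.+1) Num.sqrt (count_of l s)%:R.

Let sum_count s : (\sum_(l < K.+1) count_of l s <= size s)%N.
Proof.
elim: s => [|e s IH]; first by rewrite big1.
rewrite /reveal_count /= big_split/= -[(size s).+1]add1n; apply: leq_add => //.
rewrite /reveals eqxx; have [eK|eK] := ltnP e.1.2 K.+1.
  rewrite (bigD1 (Ordinal eK))//= eqxx big1// => l.
  by rewrite -val_eqE/= eq_sym => /negbTE ->.
by rewrite big1// => l _; rewrite (_ : _ == _ = false)//; apply/negbTE; rewrite gtn_eqF// (leq_trans (ltn_ord l)).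
Qed.

Lemma ucb_budget0 s : 0 <= ucb_budget 0 s.
Proof.
rewrite /ucb_budget addn0.
have h : \sum_(l < K.+1) (count_of l s)%:R / theta <= (size s)%:R / theta.
  rewrite -mulr_suml -natr_sum ler_wpM2r ?invr_ge0 ?ler_nat//; first exact: ltW.
have : 0 <= \sum_(l < K.+1) ((count_of l s)%:R / theta + theta - 2 * Num.sqrt (count_of l s)%:R).
  by apply: sumr_ge0 => l _; exact: sqrt_amgm.
rewrite sumrB big_split/= sumr_const card_ord -mulr_natl -mulr_sumr; lra.
Qed.

Lemma ucb_budgetS n s :
  \sum_(i < K.+2) p i * ((Num.sqrt (count_of (ucb s i) s).+1%:R)^-1 +
    \sum_(j < K.+2) q j * ucb_budget n (rcons s (nat_of_ord i, ucb s i, observed_cell (0 : R) (ucb s i) j)))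
  <= ucb_budget n.+1 s.
Proof.
apply: (@le_trans _ _ (\sum_(i < K.+2) p i * ucb_budget n.+1 s)); last by rewrite -mulr_suml p_sum mul1r.
apply: ler_sum => i _; apply: ler_wpM2l => //.
set k := ucb s i; have kK : (k < K.+1)%N by rewrite ltnS ucb_le.
have H o : ucb_budget n (rcons s (nat_of_ord i, k, o)) =
  ucb_budget n.+1 s - 2 * (Num.sqrt (count_of k s).+1%:R - Num.sqrt (count_of k s)%:R).
  rewrite /ucb_budget size_rcons addSnnS.
  have cE l : count_of l (rcons s (nat_of_ord i, k, o)) = (count_of l s + (k == l))%N.
    by rewrite /reveal_count -cats1 count_cat/= addn0 /reveals eqxx.
  under eq_bigr do rewrite cE.
  rewrite (bigD1 (Ordinal kK))//= eqxx addn1 [in RHS](bigD1 (Ordinal kK))//=.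
  under eq_bigr => l lk.
    rewrite (_ : (k == l) = false) ?addn0; last by apply/negbTE; move: lk; rewrite -val_eqE/= eq_sym.
    over.
  ring.
under eq_bigr do rewrite H.
rewrite -mulr_suml q_sum mul1r.
have := sqrt_incrementS R (count_of k s); lra.
Qed.

Lemma ucb_budget_nil : ucb_budget T [::] = T%:R / theta + K.+1%:R * theta.
Proof.
by rewrite /ucb_budget add0n big1 ?mulr0 ?subr0// => l _; rewrite sqrtr0.
Qed.

End UCB.

(** * Capped bids for [alpha > 0] *)

Section Capped.
Context (R : realType) (K : nat) (alpha L : R) (T : nat) (p q g : nat -> R).
Hypotheses (K0 : (0 < K)%N) (a01 : 0 <= alpha <= 1) (an0 : alpha != 0) (L1 : 1 <= L) (T0 : (0 < T)%N).
Hypotheses (p_ge0 : forall j, 0 <= p j) (p_sum : \sum_(j < K.+2) p j = 1).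
Hypotheses (q_sum : \sum_(j < K.+2) q j = 1).
Hypothesis g01 : forall l, (l <= K)%N -> 0 <= g l <= 1.
Hypothesis g_mono : forall k l, (k <= l <= K)%N -> g k <= g l.
Local Notation count_of := (reveal_count alpha).
Local Notation rho := (grid_rew K alpha g).
Local Notation best_idx := (best_idx K alpha g).

Let under_cap (s : state) (i k : nat) := all (fun e => (i <= e.1.1)%N ==> (k <= e.1.2)%N) s.

(** Smaller bids are observed at least as often, so the width at [k] serves both estimates; 4 is
    twice the factor 2 of [est_close]. *)
Let unbeaten (s : state) (i k : nat) := [forall k' : 'I_K.+1, (k' < k)%N ==>
  (est_rew K alpha s i k' - est_rew K alpha s i k <= 4 * width L (count_of k s))].

(* The largest bid that no smaller bid beats significantly. A bid reveals
   everything below it, so capping it by all earlier bids made at larger values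
   guarantees that each of these rounds was informative about it. *)
Definition capped (s : state) (i : nat) : nat :=
  [arg max_(k > ord0 : 'I_K.+1 | under_cap s i k && unbeaten s i k) (k : nat)].

Let cappedP s i : [/\ (capped s i <= K)%N, under_cap s i (capped s i), unbeaten s i (capped s i) &
  forall k, (k <= K)%N -> under_cap s i k -> unbeaten s i k -> (k <= capped s i)%N].
Proof.
rewrite /capped; case: arg_maxnP => [|k /andP[k1 k2] kmax].
  apply/andP; split; first by apply/allP => e _; rewrite leq0n implybT.
  by apply/forallP => k'; rewrite ltn0.
split => //; first by rewrite -ltnS.
move=> k' k'K h1 h2; apply: (kmax (Ordinal (k'K : (k' < K.+1)%N))).
by rewrite /= h1.
Qed.

Lemma capped_le s i : (capped s i <= K)%N.
Proof. by have [] := cappedP s i. Qed.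

Definition above_best (s : state) : bool := all (fun e => best_idx e.1.1 <= e.1.2)%N s.

(** The optimum stays admissible: earlier bids at larger values were at least their own optimum,
    hence at least [best_idx i], and under concentration no smaller bid seems significantly
    better. *)
Lemma best_le_capped s i : (i <= K)%N -> above_best s -> concentrated K alpha L g s ->
  (best_idx i <= capped s i)%N.
Proof.
move=> iK /allP ab cs; have [_ _ _] := cappedP s i; apply; first exact: best_idx_le.
  apply/allP => e es; apply/implyP => ie.
  by apply: leq_trans (ab e es); exact: best_idx_mono.
apply/forallP => k'; apply/implyP => k'b.
have bK := best_idx_le K alpha g i; have k'K : (k' <= K)%N by rewrite -ltnS.
have := est_close K0 a01 L1 g01 cs iK bK; have := est_close K0 a01 L1 g01 cs iK k'K.
have := best_idx_max alpha g i k'K.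
have := width_nonincreasing L (reveal_count_le s (ltnW k'b) an0).
rewrite !ler_norml => h0 h1 /andP[h2 h3] /andP[h4 h5]; lra.
Qed.

Lemma above_best_step s i o : (i <= K)%N -> above_best s -> concentrated K alpha L g s ->
  above_best (rcons s (i, capped s i, o)).
Proof.
by move=> iK ab cs; rewrite /above_best all_rcons; apply/andP; split; [exact: best_le_capped|].
Qed.

(** The only error left is overbidding, and then [unbeaten] has tested the chosen bid against the
    optimum: [4 * w] from the test and [2 * w] from each estimate. *)
Lemma capped_gap s i : (i <= K)%N -> above_best s -> concentrated K alpha L g s ->
  rho i (best_idx i) - rho i (capped s i) <= 48 * Num.sqrt L / Num.sqrt (count_of (capped s i) s).+1%:R.
Proof.
move=> iK ab cs.
have -> : 48 * Num.sqrt L / Num.sqrt (count_of (capped s i) s).+1%:R = 8 * width L (count_of (capped s i) s).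
  by rewrite /width; ring.
set w := width L _; have w0 : 0 < w by exact: width_gt0.
have := best_le_capped iK ab cs; rewrite leq_eqVlt => /predU1P[->|lt]; first by rewrite subrr mulr_ge0// ltW.
have [kK _ /forallP kb _] := cappedP s i.
have bK := best_idx_le K alpha g i.
have := kb (Ordinal (bK : (best_idx i < K.+1)%N)); rewrite /= lt/= -/w.
have := est_close K0 a01 L1 g01 cs iK bK; have := est_close K0 a01 L1 g01 cs iK kK.
have := width_nonincreasing L (reveal_count_le s (ltnW lt) an0).
rewrite !ler_norml -/w => h0 /andP[h2 h3] /andP[h4 h5] h6; lra.
Qed.

Definition higher_count (i : nat) (s : state) : nat := count (fun e => i <= e.1.1)%N s.

Definition tail (i : nat) : R := \sum_(l < K.+2) p l * (i <= l)%N%:R.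

Lemma higher_count_le s i : (higher_count i s <= count_of (capped s i) s)%N.
Proof.
rewrite /higher_count /reveal_count; have [_ /allP h _ _] := cappedP s i.
rewrite (eq_in_count (a2 := fun e => (i <= e.1.1)%N && reveals alpha e.1.2 (capped s i))).
  by apply: sub_count => e /= /andP[].
move=> e es; case: (boolP (i <= e.1.1)%N) => //= ie.
by rewrite /reveals (negbTE an0) (implyP (h e es)).
Qed.

Let theta i := Num.sqrt (T%:R * tail i).

(* By AM-GM [budget_term] is nonnegative, and it decreases on average by
   [tail i / sqrt c.+1] per round when [c] grows by one with probability [tail i]. *)
Let budget_term (n : nat) (i c : nat) : R :=
  (c%:R + n%:R * tail i) / theta i + theta i - 2 * Num.sqrt c%:R.

(** The weight [p i / tail i] turns a mean decrease of [tail i / sqrt (c + 1)] into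
    [p i / sqrt (c + 1)], the charge for a value in cell [i]. If [tail i = 0] the quotient is 0, as
    is [p i]. *)
Definition capped_budget (n : nat) (s : state) : R :=
  \sum_(i < K.+2) p i / tail i * budget_term n i (higher_count i s).

Lemma tail_ge0 i : 0 <= tail i.
Proof. by apply: sumr_ge0 => l _; rewrite mulr_ge0. Qed.

Lemma tail_ge i : (i < K.+2)%N -> p i <= tail i.
Proof.
move=> iK; rewrite /tail (bigD1 (Ordinal iK))//= leqnn mulr1 lerDl.
by apply: sumr_ge0 => l _; rewrite mulr_ge0.
Qed.

Let theta_gt0 i : 0 < tail i -> 0 < theta i.
Proof. by move=> h; rewrite sqrtr_gt0 mulr_gt0// ltr0n. Qed.

Lemma capped_budget0 s : 0 <= capped_budget 0 s.
Proof.
apply: sumr_ge0 => i _; have := tail_ge0 i; rewrite le_eqVlt => /predU1P[<-|ti].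
  by rewrite invr0 mulr0 mul0r.
apply: mulr_ge0; first by rewrite divr_ge0// ltW.
by rewrite /budget_term mul0r addr0; apply: sqrt_amgm => //; exact: theta_gt0.
Qed.

Lemma capped_budgetS n s :
  \sum_(i < K.+2) p i * ((Num.sqrt (count_of (capped s i) s).+1%:R)^-1 +
    \sum_(j < K.+2) q j * capped_budget n (rcons s (nat_of_ord i, capped s i, observed_cell alpha (capped s i) j)))
  <= capped_budget n.+1 s.
Proof.
have cE (i i' : nat) k o : higher_count i (rcons s (i', k, o)) = (higher_count i s + (i <= i'))%N.
  by rewrite /higher_count -cats1 count_cat/= addn0.
under eq_bigr => i _.
  under eq_bigr => j _.
    rewrite /capped_budget; under eq_bigr do rewrite cE.
    over.
  rewrite -mulr_suml q_sum mul1r mulrDr.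
  over.
rewrite big_split/=.
(* A value in cell [i] raises the counts of all [l <= i]; after exchanging the sums, the count at
   [l] grows with probability [tail l]. *)
have -> : \sum_(i < K.+2) p i * (\sum_(l < K.+2) p l / tail l * budget_term n l (higher_count l s + (l <= i))) =
  \sum_(l < K.+2) p l / tail l * (tail l * budget_term n l (higher_count l s).+1 +
     (1 - tail l) * budget_term n l (higher_count l s)).
  under eq_bigr do rewrite mulr_sumr.
  rewrite exchange_big/=; apply: eq_bigr => l _.
  under eq_bigr do rewrite mulrCA.
  rewrite -mulr_sumr; congr (_ * _).
  have -> : 1 - tail l = \sum_(i < K.+2) p i * (1 - (l <= i)%N%:R).
    by under [RHS]eq_bigr do rewrite mulrBr mulr1; rewrite sumrB p_sum.
  rewrite {1}/tail !mulr_suml -big_split; apply: eq_bigr => i _ /=.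
  by case: (l <= i)%N; rewrite ?addn1 ?addn0 /=; ring.
rewrite /capped_budget -big_split; apply: ler_sum => i _ /=.
set c := higher_count i s.
have := tail_ge0 i; rewrite le_eqVlt => /predU1P[t0|ti].
  have -> : p i = 0 by apply/eqP; rewrite eq_le p_ge0 andbT (le_trans (tail_ge (ltn_ord i)))// -t0.
  by rewrite !mul0r addr0.
have hc : (Num.sqrt (count_of (capped s i) s).+1%:R)^-1 <= (Num.sqrt c.+1%:R)^-1 :> R.
  by rewrite lef_pV2 ?posrE ?sqrtr_gt0 ?ltr0n// ler_sqrt// ler_nat ltnS higher_count_le.
have hinc := sqrt_incrementS R c.
apply: (@le_trans _ _ (p i / tail i * (tail i * (2 * (Num.sqrt c.+1%:R - Num.sqrt c%:R)) +
  (tail i * budget_term n i c.+1 + (1 - tail i) * budget_term n i c)))).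
  rewrite [leRHS]mulrDr mulrA divfK ?gt_eqF// lerD2r ler_wpM2l//.
  exact: le_trans hinc.
apply: ler_wpM2l; first by rewrite divr_ge0// ltW.
rewrite /budget_term -[c.+1%:R in X in X / _]natr1 -[n.+1%:R]natr1 le_eqVlt; apply/orP; left; apply/eqP.
ring.
Qed.

(** The [i]-th term is [2 * sqrt T * p i / sqrt (tail i)]. As [p i] is a difference of consecutive
    tails, concavity of the square root makes the sum telescope, whatever [p] is. *)
Lemma capped_budget_nil : capped_budget T [::] <= 4 * Num.sqrt T%:R.
Proof.
pose st i := Num.sqrt (tail i).
have h (i : 'I_K.+2) : p i / tail i * budget_term T i (higher_count i [::]) <= 4 * Num.sqrt T%:R * (st i - st i.+1).
  rewrite /budget_term /higher_count /= sqrtr0 mulr0 subr0 add0r.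
  have tE : tail i.+1 = tail i - p i.
    apply/eqP; rewrite eq_sym subr_eq addrC; apply/eqP; rewrite /tail (bigD1 i)//= leqnn mulr1; congr (_ + _).
    rewrite [RHS](bigD1 i)//= ltnn mulr0 add0r; apply: eq_bigr => l li.
    by rewrite [in RHS]ltn_neqAle eq_sym -val_eqE /= in li *; rewrite li.
  have t1 : tail i.+1 <= tail i by rewrite tE gerBl.
  have := sqrt_increment (tail_ge0 i.+1) t1.
  rewrite tE opprB addrC subrK -tE -/(st i) -/(st i.+1) => hs.
  have := tail_ge0 i; rewrite le_eqVlt => /predU1P[t0|ti].
    rewrite -t0 invr0 mulr0 mul0r mulr_ge0// ?mulr_ge0 ?sqrtr_ge0//.
    by rewrite subr_ge0 /st ler_sqrt// -t0.
  have sT : 0 < Num.sqrt T%:R :> R by rewrite sqrtr_gt0 ltr0n.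
  have sti : 0 < st i by rewrite sqrtr_gt0.
  have thE : theta i = Num.sqrt T%:R * st i by rewrite /theta sqrtrM.
  have TE : T%:R = Num.sqrt T%:R ^+ 2 :> R by rewrite sqr_sqrtr.
  have stE : tail i = st i ^+ 2 by rewrite sqr_sqrtr// ltW.
  rewrite thE [X in p i / X]stE {1}TE stE.
  have -> : p i / st i ^+ 2 * (Num.sqrt T%:R ^+ 2 * st i ^+ 2 / (Num.sqrt T%:R * st i) + Num.sqrt T%:R * st i) =
     2 * Num.sqrt T%:R * (p i / st i) by field; rewrite !gt_eqF.
  have := ler_wpM2l (ltW sT) hs; lra.
apply: le_trans (ler_sum _ (fun i _ => h i)) _.
rewrite -mulr_sumr.
have -> : \sum_(i < K.+2) (st i - st i.+1) = st 0%N - st K.+2.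
  rewrite -opprB -(telescope_sumr st (leq0n K.+2)) big_mkord -sumrN.
  by apply: eq_bigr => i _; rewrite opprB.
have -> : st 0%N = 1.
  rewrite /st (_ : tail 0 = 1) ?sqrtr1// -[RHS]p_sum; apply: eq_bigr => l _.
  by rewrite leq0n mulr1.
have : 0 <= st K.+2 by exact: sqrtr_ge0.
have : 0 <= Num.sqrt T%:R :> R by exact: sqrtr_ge0.
move: (Num.sqrt _) (st _) => x y x0 y0; nra.
Qed.

End Capped.

(** * Regret of a grid strategy *)

Section UpperBound.
Context (R : realType) (alpha : R) (F G : probability R R) (T K : nat).
Context (pol : state -> nat -> nat) (good : state -> bool) (Theta : nat -> state -> R) (c : R).
Hypotheses (a01 : 0 <= alpha <= 1) (hF : value_dist F) (T2 : (2 <= T)%N) (K0 : (0 < K)%N).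
Local Notation L := (4 * ln (T%:R : R)).
Local Notation g := (fun l => Defs.cdf G (grid R K l)).
Local Notation p := (cell_mass K F).
Local Notation q := (cell_mass K G).
Local Notation best := (best_idx K alpha g).
Local Notation gap s i := (grid_rew K alpha g i (best i) - grid_rew K alpha g i (pol s i)).

Lemma ln_horizon_ge : 1 / 2 <= ln (T%:R : R).
Proof.
have T2' : 2 <= T%:R :> R by rewrite ler_nat.
have := @ln_le_subr1 R T%:R^-1; rewrite lnV ?posrE; last by lra.
have : T%:R^-1 <= 2^-1 :> R by rewrite lef_pV2 ?posrE//; lra.
rewrite invr_gt0 => h1 /(_ ltac:(lra)) h2; lra.
Qed.

Lemma log_horizon_ge1 : 1 <= L.
Proof. have := ln_horizon_ge; lra. Qed.

Let g01 l : (l <= K)%N -> 0 <= g l <= 1.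
Proof. by move=> _; rewrite cdf_ge0 cdf_le1. Qed.

Hypothesis c0 : 0 <= c.
Hypothesis polK : forall s i, (pol s i <= K)%N.
Hypothesis gap_good : forall s i, (i <= K)%N -> good s -> concentrated K alpha L g s ->
  gap s i <= c / Num.sqrt (reveal_count alpha (pol s i) s).+1%:R.
Hypothesis good_step : forall s i o, (i <= K)%N -> good s -> concentrated K alpha L g s ->
  good (rcons s (i, pol s i, o)).
Hypothesis good_nil : good [::].
Hypothesis Theta0 : forall s, 0 <= Theta 0 s.
Hypothesis ThetaS : forall n s,
  \sum_(i < K.+2) p i * ((Num.sqrt (reveal_count alpha (pol s i) s).+1%:R)^-1 +
    \sum_(j < K.+2) q j * Theta n (rcons s (nat_of_ord i, pol s i, observed_cell alpha (pol s i) j)))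
  <= Theta n.+1 s.

Lemma regret_grid_alg :
  (regret alpha F G (grid_alg K alpha pol) T <=
    (5 * T%:R / K%:R + 6 * K.+1%:R / T%:R + c * Theta T [::])%:E)%E.
Proof.
have T0 : 0 < T%:R :> R by rewrite ltr0n (leq_trans _ T2).
pose Psi := potential K alpha L T g good Theta c.
have PsiE : Psi T [::] = 6 * K.+1%:R / T%:R + c * Theta T [::].
  rewrite /Psi /potential good_nil mulr0 add0r supermart_sum_nil expRN.
  (* The 4 in [L] leaves [3 T^2 * 2 T (K + 1) / T^4], a bounded term for [K] of order at most
     [T]. *)
  have -> : expR L = T%:R ^+ 4 by rewrite expRM_natl lnK.
  by congr (_ + _); field; rewrite gt_eqF.
rewrite -addrA -PsiE; apply: (regret_le_potential K0 a01 hF polK) => //.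
- by move=> i k iK kK; apply: best_idx_max.
- by move=> s; apply: potential_ge0.
move=> n s snT; apply: (potential_step log_horizon_ge1) => //.
- by move=> j; exact: cell_mass_ge0.
- exact: sum_cell_mass.
- exact: cell_mass_value_dist.
- by move=> j; exact: cell_mass_ge0.
- exact: sum_cell_mass.
- by move=> l lK; exact: cdf_grid.
- move=> s' i iK.
  have /andP[_ h1] := grid_rew_bounds K0 a01 g01 iK (best_idx_le K alpha g i).
  have /andP[h2 _] := grid_rew_bounds K0 a01 g01 iK (polK s' i).
  lra.
Qed.

End UpperBound.

(** * Choice of the mesh and final rates *)

Section UpperBounds.
Context (R : realType).

Let sqrt_log_le (T : nat) : (2 <= T)%N ->
  Num.sqrt (4 * ln (T%:R : R)) <= 4 * ln (T%:R : R).
Proof.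
move=> T2; have L1 := log_horizon_ge1 R T2; set L := 4 * _ in L1 *.
have sL : 1 <= Num.sqrt L by rewrite -[leLHS]sqrtr1 ler_sqrt//; lra.
rewrite -[leRHS]sqr_sqrtr; last lra.
by rewrite expr2 ler_peMr// sqrtr_ge0.
Qed.

Let cdf_grid_mono (G : probability R R) K k l : (0 < K)%N -> (k <= l <= K)%N ->
  Defs.cdf G (grid R K k) <= Defs.cdf G (grid R K l).
Proof. by move=> K0 /andP[kl _]; apply: cdf_nondecreasing; rewrite grid_le. Qed.

Let cdf01 (G : probability R R) K l : (l <= K)%N -> 0 <= Defs.cdf G (grid R K l) <= 1.
Proof. by move=> _; rewrite cdf_ge0 cdf_le1. Qed.

Let mesh (r : R) : nat := (Num.truncn r).+1.

Let mesh_bounds r : 1 <= r -> r <= (mesh r)%:R <= 2 * r /\ (mesh r).+1%:R <= 3 * r.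
Proof.
move=> r1; have h1 : r < (mesh r)%:R by exact: Num.Theory.truncnS_gt.
have h2 : (Num.truncn r)%:R <= r by rewrite Num.Theory.truncn_le; lra.
have h3 : (mesh r)%:R <= r + 1 by rewrite /mesh -natr1; lra.
by split; [apply/andP; split|rewrite -natr1]; lra.
Qed.

(** For the mesh [r] and the rate [B], [T <= r * B] brings the rounding error down to order [B].
    Terms without a logarithm are doubled, as [ln T >= 1/2]. *)
Let regret_terms_le (T : nat) (r B c : R) (K := mesh r) : (2 <= T)%N -> 1 <= r -> r <= T%:R -> T%:R <= r * B -> 0 <= c ->
  5 * T%:R / K%:R + 6 * K.+1%:R / T%:R + c * Num.sqrt (4 * ln (T%:R : R)) * B <=
    (5 * 2 + 6 * 3 * 2 + c * 4) * B * ln (T%:R : R).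
Proof.
move=> T2 r1 rT TB c0.
have [/andP[rK _] Kr] := mesh_bounds r1.
have ln2 := ln_horizon_ge R T2; set l := ln _ in ln2 *.
have T0 : 0 < T%:R :> R by lra.
have K0 : 0 < (mesh r)%:R :> R by lra.
have B1 : 1 <= B.
  have : r * 1 <= r * B by lra.
  by rewrite ler_pM2l//; lra.
have h1 : 5 * T%:R / K%:R <= 5 * B.
  rewrite ler_pdivrMr// -mulrA ler_wpM2l//.
  by apply: le_trans TB _; rewrite mulrC ler_wpM2l//; lra.
have h2 : 6 * K.+1%:R / T%:R <= 6 * 3 :> R.
  rewrite ler_pdivrMr// -mulrA ler_wpM2l//; apply: le_trans Kr _; lra.
have h3 : c * Num.sqrt (4 * l) * B <= c * (4 * l) * B.
  by apply: ler_wpM2r; [lra|apply: ler_wpM2l => //; exact: sqrt_log_le].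
have h4 : 0 <= (B - 1) * l by rewrite mulr_ge0; lra.
have h5 : 0 <= B * (l - 1 / 2) by rewrite mulr_ge0; lra.
lra.
Qed.

Lemma regret_upper_two_thirds : exists A : nat -> bandit_alg R,
  (forall T : nat, alg_valid (A T)) /\
  exists (C : R) (k : nat), 0 < C /\
    forall T : nat, (2 <= T)%N ->
    forall F G : probability R R, value_dist F -> bid_dist G ->
      (regret 0 F G (A T) T <= (C * (T%:R `^ (2 / 3)) * (ln T%:R) ^+ k)%:E)%E.
Proof.
(* Balances the rounding error [T / K] with the exploration cost [sqrt (K * T)]. *)
pose K T := mesh (T%:R `^ (1 / 3)).
exists (fun T => grid_alg (K T) 0 (ucb (K T) (4 * ln (T%:R : R)))).
split; first by move=> T; exact: alg_valid_grid_alg.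
exists (5 * 2 + 6 * 3 * 2 + 24 * 4 * 4), 1%N; split; first by lra.
move=> T T2 F G hF _; rewrite expr1.
have T0 : 0 < T%:R :> R by rewrite ltr0n (leq_trans _ T2).
pose r : R := T%:R `^ (1 / 3).
have r0 : 0 < r by rewrite powR_gt0.
have r3 : r ^+ 3 = T%:R.
  by rewrite -powR_mulrn ?ltW// /r -powRrM (_ : 1 / 3 * 3%:R = 1) ?powRr1 ?ltW//; field.
have r2 : T%:R `^ (2 / 3) = r ^+ 2.
  by rewrite -[RHS]powR_mulrn ?ltW// /r -powRrM; congr (_ `^ _); field.
have r1 : 1 <= r by rewrite -(powRr0 T%:R) /r ler_powR// ler1n; apply: leq_trans T2.
have rr : r <= r ^+ 2 by rewrite expr2 ler_peMr// ltW.
have a01 : 0 <= (0 : R) <= 1 by rewrite lexx ler01.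
have L1 := log_horizon_ge1 R T2.
have K0 : (0 < K T)%N by [].
have p0 j : 0 <= cell_mass (K T) F j by exact: cell_mass_ge0.
pose sL := Num.sqrt (4 * ln (T%:R : R)).
have sL0 : 0 <= sL by exact: sqrtr_ge0.
have := @regret_grid_alg R 0 F G T (K T) (ucb (K T) (4 * ln (T%:R : R))) xpredT
  (ucb_budget (K T) r) (24 * sL) a01 hF T2 K0.
move=> /(_ (mulr_ge0 (ler0n R 24) sL0) (ucb_le _ _)) H.
have {}H := H (fun s i iK _ cs => ucb_gap K0 L1 (@cdf01 G (K T)) iK cs).
have {}H := H (fun _ _ _ _ _ _ => isT) isT (ucb_budget0 _ r0).
have {}H := H (ucb_budgetS _ _ p0 (sum_cell_mass K0 F) (sum_cell_mass K0 G)).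
apply: le_trans H _; rewrite lee_fin.
have [_ Kr] := mesh_bounds r1.
have hT : r <= T%:R by rewrite -r3 exprS; apply: le_trans rr _; rewrite ler_peMl ?sqr_ge0.
have TB : T%:R <= r * r ^+ 2 by rewrite -exprS r3.
have := @regret_terms_le T r (r ^+ 2) (24 * 4) T2 r1 hT TB.
rewrite mulr_ge0// => /(_ isT); rewrite r2; apply: le_trans.
rewrite lerD2l ucb_budget_nil -/sL.
have hb : T%:R / r + (K T).+1%:R * r <= 4 * r ^+ 2.
  have -> : T%:R / r = r ^+ 2 by rewrite -r3; field; rewrite gt_eqF.
  by have : (K T).+1%:R * r <= 3 * r * r by [rewrite ler_wpM2r// ltW]; lra.
have := ler_wpM2l (mulr_ge0 (ler0n R 24) sL0) hb; lra.
Qed.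

Lemma regret_upper_sqrt (alpha : R) : 0 < alpha < 1 -> exists A : nat -> bandit_alg R,
  (forall T : nat, alg_valid (A T)) /\
  exists (C : R) (k : nat), 0 < C /\
    forall T : nat, (2 <= T)%N ->
    forall F G : probability R R, value_dist F -> bid_dist G ->
      (regret alpha F G (A T) T <= (C * (T%:R `^ (1 / 2)) * (ln T%:R) ^+ k)%:E)%E.
Proof.
move=> /andP[al0 al1].
have a01 : 0 <= alpha <= 1 by rewrite !ltW.
have an0 : alpha != 0 by rewrite gt_eqF.
(* The exploration cost is free of [K] here, so the mesh is dictated by the rounding error
   [T / K]. *)
pose K T := mesh (Num.sqrt (T%:R : R)).
exists (fun T => grid_alg (K T) alpha (capped (K T) alpha (4 * ln (T%:R : R)))).
split; first by move=> T; exact: alg_valid_grid_alg.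
exists (5 * 2 + 6 * 3 * 2 + 48 * 4 * 4), 1%N; split; first by lra.
move=> T T2 F G hF _; rewrite expr1.
have T0 : (0 < T)%N by exact: leq_trans T2.
pose r : R := Num.sqrt T%:R.
have -> : T%:R `^ (1 / 2) = r by rewrite div1r powR12_sqrt.
have r2 : r ^+ 2 = T%:R by rewrite sqr_sqrtr.
have r1 : 1 <= r by rewrite -[leLHS]sqrtr1 ler_sqrt// ler1n.
have L1 := log_horizon_ge1 R T2.
have K0 : (0 < K T)%N by [].
have p0 j : 0 <= cell_mass (K T) F j by exact: cell_mass_ge0.
pose sL := Num.sqrt (4 * ln (T%:R : R)).
have sL0 : 0 <= sL by exact: sqrtr_ge0.
pose g l := Defs.cdf G (grid R (K T) l).
have gm k l : (k <= l <= K T)%N -> g k <= g l by exact: cdf_grid_mono.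
have := @regret_grid_alg R alpha F G T (K T) (capped (K T) alpha (4 * ln (T%:R : R)))
  (above_best (K T) alpha g) (capped_budget (K T) T (cell_mass (K T) F)) (48 * sL) a01 hF T2 K0.
move=> /(_ (mulr_ge0 (ler0n R 48) sL0) (capped_le _ _ _)) H.
have {}H := H (fun s i iK ab cs => capped_gap K0 a01 an0 L1 (@cdf01 G (K T)) gm iK ab cs).
have {}H := H (fun s i o iK ab cs => above_best_step K0 a01 an0 L1 (@cdf01 G (K T)) gm o iK ab cs).
have {}H := H isT (capped_budget0 _ T0 p0).
have {}H := H (capped_budgetS _ _ an0 p0 (sum_cell_mass K0 F) (sum_cell_mass K0 G)).
apply: le_trans H _; rewrite lee_fin.
have TB : T%:R <= r * r by rewrite -expr2 r2.
have hT : r <= T%:R by rewrite -r2 expr2 ler_peMl//; lra.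
have := @regret_terms_le T r r (48 * 4) T2 r1 hT TB.
rewrite mulr_ge0// => /(_ isT); apply: le_trans.
rewrite lerD2l -/sL.
have hb := capped_budget_nil T0 p0 (sum_cell_mass K0 F).
have := ler_wpM2l (mulr_ge0 (ler0n R 48) sL0) hb; rewrite -/r; lra.
Qed.

End UpperBounds.

Theorem theorem1 :
  (* (1) alpha0 = 1: truthful bidding has zero regret *)
  (forall (R : realType) (F G : probability R R) (T : nat),
     value_dist F -> bid_dist G -> regret 1 F G (@truthful R) T = 0%E)
  /\
  (* (2) alpha0 = 0: O~(T^(2/3)) upper bound and Omega(T^(2/3)) lower bound *)
  (forall R : realType,
     (exists A : nat -> bandit_alg R,
        (forall T : nat, alg_valid (A T)) /\
        exists (C : R) (k : nat), 0 < C /\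
          forall T : nat, (2 <= T)%N ->
          forall F G : probability R R, value_dist F -> bid_dist G ->
            (regret 0 F G (A T) T
               <= (C * (T%:R `^ (2 / 3)) * (ln T%:R) ^+ k)%:E)%E)
     /\
     (exists c : R, 0 < c /\
        exists T0 : nat, forall T : nat, (T0 <= T)%N ->
        forall A : bandit_alg R, alg_valid A ->
        exists F G : probability R R, value_dist F /\ bid_dist G /\
          ((c * (T%:R `^ (2 / 3)))%:E <= regret 0 F G A T)%E))
  /\
  (* (3) alpha0 in (0,1): O~(T^(1/2)) upper bound and Omega(T^(1/2)) lower bound *)
  (forall (R : realType) (alpha0 : R), 0 < alpha0 < 1 ->
     (exists A : nat -> bandit_alg R,
        (forall T : nat, alg_valid (A T)) /\
        exists (C : R) (k : nat), 0 < C /\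
          forall T : nat, (2 <= T)%N ->
          forall F G : probability R R, value_dist F -> bid_dist G ->
            (regret alpha0 F G (A T) T
               <= (C * (T%:R `^ (1 / 2)) * (ln T%:R) ^+ k)%:E)%E)
     /\
     (exists c : R, 0 < c /\
        exists T0 : nat, forall T : nat, (T0 <= T)%N ->
        forall A : bandit_alg R, alg_valid A ->
        exists F G : probability R R, value_dist F /\ bid_dist G /\
          ((c * (T%:R `^ (1 / 2)))%:E <= regret alpha0 F G A T)%E)).
Proof.
split; first by move=> R F G T hF _; exact: regret_truthful.
split=> [R|R alpha0 a01].
  by split; [exact: regret_upper_two_thirds|exact: regret_lower_two_thirds].
by split; [exact: regret_upper_sqrt|exact: regret_lower_sqrt].
Qed.
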